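(* Let $i\in[N]$ with $i\le N/2$. The dimension of $E_iV$ is given as follows. (i) If $i\in\mathbb Z$, then $$\dim E_iV=\mu_0\binom{N}{i}_q+\mu_2\binom{N-2}{i-1}_q+\mu_4\binom{N-4}{i-2}_q+\cdots+\mu_{2i}\binom{N-2i}{0}_q.$$ (ii) If $i\notin\mathbb Z$, then $$\dim E_iV=\mu_1\binom{N-1}{i-1/2}_q+\mu_3\binom{N-3}{i-3/2}_q+\mu_5\binom{N-5}{i-5/2}_q+\cdots+\mu_{2i}\binom{N-2i}{0}_q.$$
   Context: Let $\mathbb F_q$ be a finite field with $q$ elements, let $N,M$ be positive integers, let $H$ be a vector space over $\mathbb F_q$ of dimension $N+M$, and fix a subspace $h\subseteq H$ of dimension $M$. Let $X$ be the set of subspaces $y\subseteq H$ with $y\cap h=0$, partially ordered by inclusion (the Attenuated Space poset $\mathcal A_q(N,M)$). For $y,z\in X$, $z$ covers $y$ when $y\subseteq z$ and $\dim z-\dim y=1$; $y,z$ are adjacent when one of them covers the other. Let $\mathrm{Mat}_X(\mathbb C)$ be the algebra of complex matrices with rows and columns indexed by $X$, acting on $V=\mathbb C^X$ by left multiplication. The $q$-adjacency matrix $A\in\mathrm{Mat}_X(\mathbb C)$ has $(y,z)$-entry $1$ if $y$ covers $z$; $q^{\dim y}$ if $z$ covers $y$; and $0$ if $y,z$ are not adjacent. Let $[N]=\{i: 2i\in\mathbb Z,\ 0\le i\le N\}=\{0,1/2,1,\ldots,N\}$. The matrix $A$ is diagonalizable with mutually distinct eigenvalues $\theta_i=\frac{q^{N-i}-q^i}{q-1}q^{M/2}$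 $(i\in[N])$, where $q^{1/2}>0$. For $i\in[N]$, $E_i$ is the primitive idempotent of $A$ for $\theta_i$ (the projection acting as the identity on the $\theta_i$-eigenspace and as $0$ on the other eigenspaces), so $E_iV$ is the $\theta_i$-eigenspace of $A$. For $n\in\mathbb N=\{0,1,2,\dots\}$, $[n]_q=\frac{q^n-1}{q-1}$, $[n]_q^!=[n]_q[n-1]_q\cdots[1]_q$ with $[0]_q^!=1$, and $\binom{n}{i}_q=\frac{[n]_q^!}{[i]_q^![n-i]_q^!}$ for $0\le i\le n$, with $\binom{n}{i}_q=0$ for integers $i<0$ or $i>n$. For an integer $r$, $$\mu_r=\binom{N}{r}_q\binom{M}{r}_q(q^r-1)(q^r-q)\cdots(q^r-q^{r-1}),$$ so that $\mu_0=1$ and $\mu_r\neq 0$ if and only if $0\le r\le\min(N,M)$. *)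

(* Defs.v *)
From HB Require Import structures.
From mathcomp Require Import all_boot all_order all_algebra.
From mathcomp Require Import reals exp complex.

Set Implicit Arguments.
Unset Strict Implicit.
Unset Printing Implicit Defensive.

Import Order.TTheory GRing.Theory Num.Theory.
Local Open Scope ring_scope.

(* MathComp does not declare {vspace H} as a finType when the scalars are
   finite. *)
Section FiniteVspace.
Variables (F : finFieldType) (H : vectType F).
HB.instance Definition _ := isCountable.Build {vspace H}
  (pcan_pickleK (can_pcan VectorInternalTheory.vs2mxK)).
HB.instance Definition _ := isFinite.Build {vspace H}
  (pcan_enumP (can_pcan (@VectorInternalTheory.vs2mxK F H))).
End FiniteVspace.

Section AttenuatedSpace.
Variables (F : finFieldType) (H : vectType F) (h : {vspace H}).

Definition attenuated : finType := {y : {vspace H} | (y :&: h == 0)%VS}.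

Definition covers (z y : attenuated) : bool :=
  (val y <= val z)%VS && (\dim (val z) == (\dim (val y)).+1).

(* MathComp matrices are indexed by ordinals: row and column number a stand
   for the element [enum_val a] of the poset. *)
Definition qadj_mx (R : realType) : 'M[R[i]]_#|attenuated| :=
  \matrix_(a, b)
    let y := enum_val a in
    let z := enum_val b in
    if covers y z then 1
    else if covers z y then (#|F| ^ \dim (val y))%:R
    else 0.
End AttenuatedSpace.

(* Matrices act on column vectors, whereas [eigenspace] of mxalgebra is about
   row vectors.  If A is diagonalizable, exactly one E satisfies this. *)
Definition primitive_idempotent (K : fieldType) (n : nat) (A : 'M[K]_n) (a : K)
    (E : 'M[K]_n) : Prop :=
  (forall v : 'cV[K]_n, A *m v = a *: v -> E *m v = v) /\
  (forall (b : K) (v : 'cV[K]_n), b != a -> A *m v = b *: v -> E *m v = 0).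

Lemma primitive_idempotent_exists (K : fieldType) (n : nat) (A : 'M[K]_n)
  (a : K) : exists E, primitive_idempotent A a E.
Proof.
case: n A => [|n] A.
  by exists 0; split=> [v _|b v _ _]; apply/matrixP=> -[].
have hornerv (p : {poly K}) b (v : 'cV[K]_n.+1) :
    A *m v = b *: v -> horner_mx A p *m v = p.[b] *: v.
  move=> Av; elim/poly_ind: p => [|p c IHp].
    by rewrite rmorph0 mul0mx horner0 scale0r.
  rewrite rmorphD rmorphM /= horner_mx_X horner_mx_C hornerMXaddC.
  rewrite mulmxDl mul_scalar_mx scalerDl; congr (_ + _).
  by rewrite -mulmxA Av -scalemxAr IHp scalerA mulrC.
have p0 := monic_neq0 (char_poly_monic A).
have [m [r]] := multiplicity_XsubC (char_poly A) a.
rewrite p0 /= => ra pE.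
exists (horner_mx A (r.[a]^-1 *: r)); split=> [v /hornerv->|b v ba Av].
  by rewrite hornerZ mulVf ?scale1r.
have [->|v0] := eqVneq v 0; first by rewrite mulmx0.
have: (char_poly A).[b] *: v = 0.
  by rewrite -(hornerv _ _ _ Av) Cayley_Hamilton mul0mx.
move/eqP; rewrite scaler_eq0 (negPf v0) orbF pE hornerM mulf_eq0 horner_exp.
rewrite expf_eq0 hornerXsubC subr_eq0 (negPf ba) andbF orbF => /eqP rb.
by rewrite (hornerv _ _ _ Av) hornerZ rb mulr0 scale0r.
Qed.

Section Numbers.
Variable R : realType.

Definition half_ints (N : nat) : {pred R} :=
  [pred i : R | [&& 2 * i \is a Num.int, 0 <= i & i <= N%:R]].

Variable q : nat.

Definition theta (N M : nat) (i : R) : R :=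
  (q%:R `^ (N%:R - i) - q%:R `^ i) / (q%:R - 1) * q%:R `^ (M%:R / 2).

Definition qint (n : nat) : R := (q%:R ^+ n - 1) / (q%:R - 1).

Definition qfact (n : nat) : R := \prod_(1 <= j < n.+1) qint j.

Definition qbinom (n : nat) (k : int) : R :=
  if 0 <= k <= n%:Z then qfact n / (qfact `|k|%N * qfact (n - `|k|)%N)
  else 0.

Definition mu (N M r : nat) : R :=
  qbinom N r * qbinom M r * \prod_(0 <= j < r) (q%:R ^+ r - q%:R ^+ j).
End Numbers.

(* Main.v *)
(** Translating [H] by maps [1 + phi], where [phi : H -> h] kills [h], acts on
    the poset by automorphisms that preserve [y + h].  The characters of this
    abelian group are indexed by M-tuples [c] in H/h.  The c-isotypic part has
    a basis indexed by the [y + h] that contain [c], i.e. by a projective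
    geometry of dimension N - rho, where rho is the rank of [c], and on it A
    becomes the q-adjacency matrix of that geometry up to a scalar.  For every
    U containing [h] and [c], with k = dim U - M, the function
      chi_c(y) (-Q)^dim(y cap U) / (s Q)^dim(y),
      Q = q^(k - rho), s = q^((M + rho)/2),
    is an eigenvector for theta_(k - rho/2).  These functions form a basis, so
    dim E_i V counts the pairs (c, U) with k - rho/2 = i. *)
From HB Require Import structures.
Require Import Defs.
From mathcomp Require Import all_boot all_order all_algebra all_field.
From mathcomp Require Import reals exp complex ring lra zify.
Set Implicit Arguments.
Unset Strict Implicit.
Unset Printing Implicit Defensive.
Import Order.TTheory GRing.Theory Num.Theory.
Local Open Scope ring_scope.

(** * Gaussian binomials and counting of subspaces *)

(** Neither A nor the transvections separate the eigenvectors with the same c and the same dim U.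
    Their independence comes from Moebius inversion over the subspaces above h and c, which works
    because no factor -Q - q^j vanishes. That the eigenvectors span is a matter of counting: y is
    the graph of a linear map from (y + h)/h to h, which is encoded by an M-tuple in (y + h)/h, so
    there are at most as many y as pairs (c, U). The constants solve a small system. On the support
    of chi_c, a step to a neighbour multiplies the function by sQ or -s downwards and by -1/s or
    1/(sQ) upwards; with s^2 = q^(M + rho) all terms that depend on y cancel. In the final formula
    mu_rho is the number of tuples c of rank rho, that is, of N x M matrices of rank rho. The
    condition k - rho/2 = i puts U at height i - rho/2 above the span of h and c, which gives the
    other factor and fixes the parity of rho. *)

Section GaussianBinomial.
Variables (K : numFieldType) (q : K).
Hypothesis q_gt1 : 1 < q.

(** The Gaussian binomial, by the recursion that arises in [card_interval] when subspaces are
    counted through their atoms. It vanishes for n < m without a case distinction. *)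
Fixpoint gbin (n m : nat) {struct m} : K :=
  match m, n with
  | 0%N, _ => 1
  | _.+1, 0%N => 0
  | m'.+1, n'.+1 => (q ^+ n - 1) / (q ^+ m - 1) * gbin n' m'
  end.

Arguments gbin : simpl never.

Lemma q_neq0 : q != 0.
Proof. by rewrite gt_eqF // (lt_trans ltr01). Qed.

Lemma qX_neq1 m : q ^+ m.+1 - 1 != 0.
Proof. by rewrite subr_eq0 gt_eqF // exprn_egt1. Qed.

Lemma gbinn0 n : gbin n 0 = 1. Proof. by case: n. Qed.

Lemma gbinSS n m :
  gbin n.+1 m.+1 = (q ^+ n.+1 - 1) / (q ^+ m.+1 - 1) * gbin n m.
Proof. by []. Qed.

Lemma gbin0S m : gbin 0 m.+1 = 0. Proof. by []. Qed.

Lemma gbin_small n m : (n < m)%N -> gbin n m = 0.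
Proof.
by elim: n m => [|n IHn] [|m] // lt_nm; rewrite gbinSS IHn // mulr0.
Qed.

Lemma gbin_pascal n m :
  gbin n.+1 m.+1 = q ^+ m.+1 * gbin n m.+1 + gbin n m.
Proof.
elim: n m => [|n IHn] m.
  case: m => [|m]; last by rewrite gbinSS !gbin0S !mulr0 add0r.
  by rewrite gbinSS gbin0S gbinn0 mulr1 mulr0 add0r divff // (qX_neq1 0).
rewrite gbinSS [gbin n.+1 m.+1]gbinSS.
case: m => [|m]; first by rewrite !gbinn0 !exprS expr0; field;
  exact: (qX_neq1 0).
have q1 := qX_neq1 m; have q2 := qX_neq1 m.+1.
set b := gbin n m.+1; set g := gbin n.+1 m.+1.
have E1 : g = q ^+ m.+1 * b + gbin n m by apply: IHn.
have E2 : g * (q ^+ m.+1 - 1) = (q ^+ n.+1 - 1) * gbin n m.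
  by rewrite /g gbinSS mulrAC divfK.
have E3 : g * (q ^+ n.+1 - q ^+ m.+1) = (q ^+ n.+1 - 1) * (q ^+ m.+1 * b).
  have -> : q ^+ m.+1 * b = g - gbin n m by rewrite E1 addrK.
  by rewrite [RHS]mulrBr -E2; ring.
(* Splits q^(n+2) - 1 as q (q^(n+1) - q^(m+1)) + (q^(m+2) - 1). *)
transitivity ((q * (g * (q ^+ n.+1 - q ^+ m.+1)) + g * (q ^+ m.+2 - 1))
               / (q ^+ m.+2 - 1)).
  by rewrite mulrAC; congr (_ / _); rewrite !exprS; ring.
rewrite E3 mulrDl mulfK //; congr (_ + _).
by rewrite [q ^+ m.+2]exprS; field; rewrite -exprS.
Qed.

(** For a prime power q both sides count injective linear maps from an m-space to an n-space: on the
    left by their image, on the right by the images of a basis. *)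
Lemma gbin_prod n m :
  gbin n m * \prod_(j < m) (q ^+ m - q ^+ j) = \prod_(j < m) (q ^+ n - q ^+ j).
Proof.
have shift k l : \prod_(j < l.+1) (q ^+ k.+1 - q ^+ j) =
    (q ^+ k.+1 - 1) * (q ^+ l * \prod_(j < l) (q ^+ k - q ^+ j)).
  rewrite big_ord_recl expr0; congr (_ * _).
  have -> : q ^+ l = \prod_(j < l) q by rewrite prodr_const card_ord.
  by rewrite -big_split; apply: eq_bigr => j _ /=; rewrite mulrBr -!exprS.
elim: m n => [|m IHm] n; first by rewrite gbinn0 !big_ord0 mulr1.
case: n => [|n]; first by rewrite gbin0S mul0r big_ord_recl subrr mul0r.
rewrite gbinSS.
rewrite !shift -(IHm n); field; exact: qX_neq1.
Qed.

(** Cauchy's q-binomial theorem. For a prime power q and x = q^k both sides count linear maps from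
    an n-space to a k-space, the right one by rank. *)
Lemma q_binomial_theorem (x : K) n :
  x ^+ n = \sum_(m < n.+1) gbin n m * \prod_(j < m) (x - q ^+ j).
Proof.
elim: n => [|n IHn]; first by rewrite big_ord1 gbinn0 big_ord0 mulr1.
rewrite big_ord_recl gbinn0 big_ord0 mulr1.
under eq_bigr => m _.
  rewrite lift0 gbin_pascal mulrDl; over.
rewrite big_split addrA.
(* After an index shift the two halves of Pascal's rule recombine termwise, by q^m + (x - q^m) =
   x. *)
have -> : 1 + \sum_(m < n.+1) q ^+ m.+1 * gbin n m.+1
                 * \prod_(j < m.+1) (x - q ^+ j)
   = \sum_(m < n.+1) q ^+ m * gbin n m * \prod_(j < m) (x - q ^+ j).
  rewrite big_ord_recr /= gbin_small ?ltnSn // mulr0 mul0r addr0.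
  by rewrite [RHS]big_ord_recl gbinn0 big_ord0 !mulr1 expr0.
rewrite -big_split exprS IHn mulr_sumr; apply: eq_bigr => m _.
by rewrite big_ord_recr /=; ring.
Qed.

Lemma gbinn1 n : gbin n 1 = (q ^+ n - 1) / (q - 1).
Proof. by case: n => [|n];
  rewrite ?gbin0S ?subrr ?mul0r // gbinSS gbinn0 mulr1. Qed.

Lemma gbinSn n : gbin n.+1 n = (q ^+ n.+1 - 1) / (q - 1).
Proof.
elim: n => [|n IHn]; first by rewrite gbinn0 divff // (qX_neq1 0).
by rewrite gbinSS IHn mulrA divfK // qX_neq1.
Qed.

End GaussianBinomial.
Arguments gbin : simpl never.

Lemma card_vect_vspace (F : finFieldType) (H : vectType F) (U : {vspace H}) :
  #|[set v : finvect_type H | (v : H) \in U]| = (#|F| ^ \dim U)%N.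
Proof.
case: H U => T cT U.
rewrite -(@card_vspace F (finvect_type (Vector.Pack cT)) cT U).
by apply: eq_card => v; rewrite inE.
Qed.

Section Counting.
Variables (F : finFieldType) (H : vectType F).
Implicit Types U V W Z : {vspace H}.
Local Notation q := #|F|.

Definition interval Z V m : {set {vspace H}} :=
  [set W | (Z <= W <= V)%VS & \dim W == (\dim Z + m)%N].

Lemma dim_add_line Z (v : H) :
  v \notin Z -> \dim (Z + <[v]>) = (\dim Z).+1.
Proof.
move=> vZ; have v0 : v != 0 by apply: contraNneq vZ => ->; apply: mem0v.
have dvZ : (Z :&: <[v]>)%VS = 0%VS.
  apply/eqP; rewrite -subv0; apply/subvP => u /memv_capP[uZ /vlineP[k uE]].
  rewrite memv0 uE scaler_eq0 (negPf v0) orbF; apply: contraNT vZ => k0.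
  by rewrite -(scalerK k0 v) -uE memvZ.
by rewrite dimv_disjoint_sum // dim_vline v0 addn1.
Qed.

Lemma add_line_eq Z W (v : H) :
  (Z <= W)%VS -> \dim W = (\dim Z).+1 -> v \notin Z ->
  (Z + <[v]> == W)%VS = (v \in W).
Proof.
move=> ZW dW vZ; apply/eqP/idP => [<-|vW].
  by apply: (subvP (addvSr _ _)); apply: memv_line.
apply/eqP; rewrite eqEdim subv_add ZW -memvE vW /=.
by rewrite dim_add_line // dW.
Qed.

Lemma card_vspaceD Z V : (Z <= V)%VS ->
  #|[set v : finvect_type H | ((v : H) \in V) && ((v : H) \notin Z)]|
    = (q ^ \dim V - q ^ \dim Z)%N.
Proof.
move=> ZV.
rewrite -!card_vect_vspace -cardsDS; last by apply/subsetP=> v; rewrite !inE;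
  apply/subvP.
by apply: eq_card => v; rewrite !inE andbC.
Qed.

(** Double count of the vectors of V outside Z: each lies in exactly one atom, [Z + <[v]>], and all
    atoms contain equally many of them. *)
Lemma card_atoms Z V : (Z <= V)%VS ->
  (#|interval Z V 1| * (q ^ (\dim Z).+1 - q ^ \dim Z) =
   q ^ \dim V - q ^ \dim Z)%N.
Proof.
move=> ZV; rewrite -(card_vspaceD ZV) -[RHS]sum1_card.
rewrite (partition_big (fun v : finvect_type H => Z + <[v : H]>)%VS
                       (mem (interval Z V 1))) /=; last first.
  move=> v; rewrite !inE => /andP[vV vZ].
  by rewrite addvSl subv_add ZV -memvE vV (dim_add_line vZ) addn1 eqxx.
rewrite -[LHS](sum_nat_const (mem (interval Z V 1))); apply: eq_bigr => W;
  rewrite inE addn1.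
case/andP=> /andP[ZW WV] /eqP dW.
rewrite -dW -card_vspaceD // -sum1_card; apply: eq_bigl => v; rewrite !inE.
have [vZ|vZ] := boolP ((v : H) \in Z); rewrite /= ?andbF // !andbT.
by rewrite (add_line_eq ZW dW vZ) andb_idl // => /(subvP WV).
Qed.

(** Both sides count the flags Z < Z1 <= W whose first step has dimension one. *)
Lemma sum_card_interval Z V m :
  (\sum_(Z1 in interval Z V 1) #|interval Z1 V m| =
   \sum_(W in interval Z V m.+1) #|interval Z W 1|)%N.
Proof.
under eq_bigr do rewrite -sum1_card; under [RHS]eq_bigr do rewrite -sum1_card.
rewrite (exchange_big_dep (mem (interval Z V m.+1))) /=.
  apply: eq_bigr => W; rewrite inE => /andP[/andP[ZW WV] /eqP dW].
  apply: eq_bigl => Z1; rewrite !inE WV dW andbT.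
  have [-> | //] := eqVneq (\dim Z1) (\dim Z + 1)%N; rewrite ?andbF //.
  rewrite addn1 addSnnS eqxx !andbT.
  have [Z1W|] := boolP (Z1 <= W)%VS; last by rewrite !andbF.
  by rewrite (subv_trans Z1W WV) andbT.
move=> Z1 W; rewrite !inE.
case/andP=> /andP[ZZ1 Z1V] /eqP-> /andP[/andP[Z1W ->]] /eqP->.
by rewrite (subv_trans ZZ1 Z1W) addn1 addSnnS eqxx.
Qed.

Lemma card_finField_gt1 (K : numDomainType) : 1 < q%:R :> K.
Proof. by rewrite ltr1n finNzRing_gt1. Qed.

Lemma card_interval (K : numFieldType) Z V m : (Z <= V)%VS ->
  #|interval Z V m|%:R = gbin (q%:R : K) (\dim V - \dim Z) m.
Proof.
have q1 := card_finField_gt1 K.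
have q0 : (0 < q)%N by apply: ltnW (finNzRing_gt1 F).
have natB a b : (a <= b)%N ->
    (q ^ b - q ^ a)%:R = q%:R ^+ a * (q%:R ^+ (b - a) - 1) :> K.
  move=> ab; rewrite natrB ?leq_pexp2l // mulrBr -exprD subnKC //.
  by rewrite mulr1 !natrX.
have atoms Z1 V1 : (Z1 <= V1)%VS ->
    #|interval Z1 V1 1|%:R * (q%:R - 1) = q%:R ^+ (\dim V1 - \dim Z1) - 1 :> K.
  move=> ZV1; have := congr1 (fun n => n%:R : K) (card_atoms ZV1).
  rewrite natrM !natB ?dimvS // subSnn expr1 mulrCA => /mulfI -> //.
  by rewrite expf_neq0 // pnatr_eq0 -lt0n.
elim: m Z => [|m IHm] Z ZV.
  rewrite gbinn0 (_ : interval Z V 0 = [set Z]) ?cards1 //.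
  apply/setP => W; rewrite !inE addn0 [W == Z]eq_sym eqEdim.
  apply/andP/andP => [[/andP[ZW _] /eqP->] | [ZW dWZ]] //.
  have dW : \dim W == \dim Z by rewrite eqn_leq dWZ dimvS.
  rewrite dW ZW andTb; split => //; suff <- : Z = W by [].
  by apply/eqP; rewrite eqEdim ZW.
have qm := qX_neq1 q1 m; apply: (mulIf qm).
have q1' : q%:R - 1 != 0 :> K by have := qX_neq1 q1 0; rewrite expr1.
have := congr1 (fun n => n%:R * (q%:R - 1) : K) (sum_card_interval Z V m).
rewrite !natr_sum.
have -> : \sum_(W in interval Z V m.+1) #|interval Z W 1|%:R =
   \sum_(W in interval Z V m.+1) (q%:R ^+ m.+1 - 1) / (q%:R - 1) :> K.
  apply: eq_bigr => W; rewrite inE => /andP[/andP[ZW WV] /eqP dW].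
  apply: (mulIf q1'); rewrite atoms // dW divfK //.
  by rewrite addKn.
rewrite sumr_const -[_ *+ #|_|]mulr_natl mulrA divfK // => <-.
have -> : \sum_(Z1 in interval Z V 1) #|interval Z1 V m|%:R =
   \sum_(Z1 in interval Z V 1) gbin (q%:R : K) (\dim V - \dim Z).-1 m.
  apply: eq_bigr => Z1; rewrite inE => /andP[/andP[ZZ1 Z1V] /eqP dZ1].
  by rewrite IHm // dZ1 subnDA subn1.
rewrite sumr_const -[_ *+ #|_|]mulr_natl mulrAC atoms //.
case: (\dim V - \dim Z)%N => [|d]; first by rewrite gbin0S subrr !mul0r.
by rewrite gbinSS /= mulrAC divfK // qX_neq1.
Qed.

End Counting.

(** Induction on the tuple: if the others span dimension k, a new vector lies in their span in q^k
    ways and outside it in q^N - q^k ways, which is Pascal's rule. The resulting number is mu_r, see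
    [muE]. *)
Lemma card_tuple_span (K : numFieldType) (F : finFieldType) (N m r : nat) :
  #|[set c : m.-tuple 'rV[F]_N | \dim <<c>> == r]|%:R =
  gbin (#|F|%:R : K) m r * \prod_(j < r) (#|F|%:R ^+ N - #|F|%:R ^+ j).
Proof.
set q : K := #|F|%:R; have q1 : 1 < q by apply: card_finField_gt1.
have cardin (U : {vspace 'rV[F]_N}) :
    #|[set v : 'rV[F]_N | v \in U]|%:R = q ^+ \dim U :> K.
  rewrite -natrX -card_vspace; congr (_%:R).
  by apply: eq_card => v; rewrite inE.
have cardout (U : {vspace 'rV[F]_N}) :
    #|[set v : 'rV[F]_N | v \notin U]|%:R = q ^+ N - q ^+ \dim U :> K.
  have -> : q ^+ N = #|{: 'rV[F]_N}|%:R by rewrite card_mx mul1n natrX.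
  rewrite -cardin -(cardsC [set v | v \in U]).
  rewrite natrD addrAC subrr add0r; congr (_%:R).
  by apply: eq_card => v; rewrite !inE.
elim: m r => [|m IHm] r.
  have -> : [set c : 0.-tuple 'rV[F]_N | \dim <<c>> == r] =
            if r == 0 then setT else set0.
    apply/setP => c; rewrite !inE tuple0 span_nil dimv0 eq_sym.
    by case: (r == 0)%N; rewrite !inE.
  case: r => [|r]; rewrite ?gbin0S ?mul0r ?cards0 // gbinn0 big_ord0 mulr1.
  by rewrite cardsT card_tuple expn0.
have split_sum : #|[set c : m.+1.-tuple 'rV[F]_N | \dim <<c>> == r]|%:R =
  \sum_(c : m.-tuple 'rV[F]_N)
     ((\dim <<c>> == r)%:R * q ^+ \dim <<c>> +
     ((\dim <<c>>).+1 == r)%:R * (q ^+ N - q ^+ \dim <<c>>)) :> K.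
  rewrite -sum1_card natr_sum big_mkcond.
  rewrite (reindex (fun p : m.-tuple 'rV[F]_N * 'rV[F]_N =>
                      cons_tuple p.2 p.1)) /=; last first.
    exists (fun c => (behead_tuple c, thead c)) => [[c v] _|c _] /=.
      by congr (_, _); apply: val_inj.
    by rewrite [RHS]tuple_eta.
  rewrite -(pair_big xpredT xpredT (fun (c : m.-tuple 'rV[F]_N) v =>
     if cons_tuple v c \in [set c : m.+1.-tuple 'rV[F]_N | \dim <<c>> == r]
     then 1%:R else 0)) /=.
  apply: eq_bigr => c _; rewrite (bigID (fun v => v \in <<c>>%VS)) /=.
  congr (_ + _).
    rewrite -cardin -sum1_card natr_sum mulr_sumr.
    rewrite [RHS](eq_bigl (fun v => v \in <<c>>%VS)); last first.
      by move=> v; rewrite inE.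
    apply: eq_bigr => v vc; rewrite inE span_cons.
    rewrite (addv_idPr _) -?memvE //.
    by case: eqP; rewrite ?mul1r ?mul0r.
  rewrite -cardout -sum1_card natr_sum mulr_sumr.
  rewrite [RHS](eq_bigl (fun v => v \notin <<c>>%VS)); last first.
    by move=> v; rewrite inE.
  apply: eq_bigr => v vc; rewrite inE span_cons addvC dim_add_line //.
  by case: eqP; rewrite ?mul1r ?mul0r.
have pick k (f : nat -> K) : \sum_(c : m.-tuple 'rV[F]_N)
    (\dim <<c>> == k)%:R * f (\dim <<c>>) =
    gbin q m k * \prod_(j < k) (q ^+ N - q ^+ j) * f k.
  rewrite -IHm -sum1_card natr_sum mulr_suml [RHS]big_mkcond.
  apply: eq_bigr => c _; rewrite inE.
  by case: eqP => [->|_]; rewrite ?mul0r.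
rewrite split_sum big_split /= (pick r (fun k => q ^+ k)).
case: r split_sum => [|r] _.
  rewrite [X in _ + X]big1 ?addr0 ?big_ord0 ?gbinn0 ?expr0 ?mulr1 // => c _.
  by rewrite mul0r.
rewrite (pick r (fun k => q ^+ N - q ^+ k)) gbin_pascal // big_ord_recr /=.
by ring.
Qed.

(** * Transvections and characters *)

Section DirectPi.
Variables (F : fieldType) (H : vectType F).
Implicit Types (U V W : {vspace H}).

Lemma daddv_piP U V u x :
  (U :&: V = 0)%VS -> u \in U -> x - u \in V -> daddv_pi U V x = u.
Proof.
move=> UV0 uU xuV; have xUV : x \in (U + V)%VS.
  by rewrite -(subrK u x) addrC memv_add.
have /directv_add_unique dUV := introT directv_addP UV0.
have := dUV _ u _ (x - u) (memv_pi U V x) uU (memv_pi V U x) xuV.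
by rewrite daddv_pi_add // [u + _]addrC subrK eqxx => /esym/andP[/eqP].
Qed.

Lemma daddv_pi_sub U V x :
  (U :&: V = 0)%VS -> x \in (U + V)%VS -> x - daddv_pi U V x \in V.
Proof.
move=> UV0 xUV.
by rewrite -{1}(daddv_pi_add UV0 xUV) addrC addKr memv_pi.
Qed.

End DirectPi.

Section Transvections.
Variables (F : fieldType) (H : vectType F) (h : {vspace H}).
Implicit Types (U V W : {vspace H}) (phi : 'End(H)).

Definition transvecting phi := (limg phi <= h)%VS && (h <= lker phi)%VS.

Section OneTransvection.
Variables (phi : 'End(H)) (phiP : transvecting phi).
Local Notation tau := (\1 + phi)%VF.

Lemma transE x : tau x = x + phi x.
Proof. by rewrite add_lfunE id_lfunE. Qed.

Lemma trans_im x : phi x \in h.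
Proof. by case/andP: phiP => /subvP im _; apply: im;
  apply: memv_img (memvf x). Qed.

Lemma trans_ker x : x \in h -> phi x = 0.
Proof. by case/andP: phiP => _ /subvP kr /kr; rewrite memv_ker => /eqP. Qed.

Lemma trans_ker0 : lker tau == 0%VS.
Proof.
rewrite -subv0; apply/subvP => x; rewrite memv_ker transE memv0 addr_eq0.
move=> /eqP xE; suff xh : phi x = 0 by rewrite xE xh oppr0.
by apply: trans_ker; rewrite xE memvN trans_im.
Qed.

Lemma trans_dim U : \dim (tau @: U) = \dim U.
Proof. by rewrite limg_dim_eq // (eqP trans_ker0) capv0. Qed.

Lemma trans_fix U : (h <= U)%VS -> (tau @: U)%VS = U.
Proof.
move=> hU; apply/eqP; rewrite eqEdim trans_dim leqnn andbT.
apply/subvP => _ /memv_imgP[x xU ->]; rewrite transE memvD //.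
by apply: (subvP hU); apply: trans_im.
Qed.

Lemma trans_cap U V : (h <= V)%VS -> \dim (tau @: U :&: V) = \dim (U :&: V).
Proof.
by move=> hV; rewrite -{1}(trans_fix hV) -lker0_img_cap ?trans_ker0 //
  trans_dim.
Qed.

Lemma trans_add U : (tau @: U + h = U + h)%VS.
Proof.
by rewrite -{1}(trans_fix (subvv h)) -limgD trans_fix // addvSr.
Qed.

End OneTransvection.

(** The component of v in a complement of W has a nonzero coordinate; this coordinate, normalized at
    v and multiplied by b, is the map. *)
Lemma exists_lfun W v b : v \notin W ->
  exists phi : 'End(H), [/\ (limg phi <= <[b]>)%VS, (W <= lker phi)%VS & phi v
    = b].
Proof.
move=> vW; pose pi := daddv_pi W^C W.
have cW : (W^C :&: W = 0)%VS by rewrite capvC capv_compl.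
have sW x : x \in (W^C + W)%VS by rewrite addvC addv_complf memvf.
have v0 : pi v != 0.
  apply: contraNneq vW => piv; rewrite -(subr0 v) -piv.
  exact: daddv_pi_sub.
have [k vk] : exists k, coord (vbasis fullv) k (pi v) != 0.
  apply/existsP; rewrite -negb_forall; apply: contraNN v0 => /forallP vk.
  rewrite (coord_vbasis (memvf (pi v))) big1 // => k _.
  by rewrite (eqP (vk k)) scale0r.
pose a := (coord (vbasis fullv) k (pi v))^-1.
pose f x := (a * coord (vbasis fullv) k (pi x)) *: b.
have f_lin : linear f.
  by move=> c x y; rewrite /f !linearP /= mulrDr scalerDl mulrCA scalerA.
pose fL : {linear H -> H} := HB.pack f (GRing.isLinear.Build _ _ _ _ f f_lin).
have fE x : linfun fL x = f x by rewrite lfunE.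
exists (linfun fL); split.
- by apply/subvP => _ /memv_imgP[x _ ->]; rewrite fE memvZ // memv_line.
- apply/subvP => x xW; rewrite memv_ker fE /f.
  by rewrite (@daddv_piP _ _ _ _ 0) ?mem0v ?subr0 // linear0 mulr0 scale0r.
- by rewrite fE /f mulVf // scale1r.
Qed.

End Transvections.

Section Characters.
Variables (F : fieldType) (H : vectType F) (h : {vspace H}).
Local Notation M := (\dim h).
Local Notation N := (\dim (h^C)%VS).
Implicit Types (U V W y z : {vspace H}) (c : M.-tuple 'rV[F]_N) (g : 'End(H)).

Definition vlift_fun (u : 'rV[F]_N) : H :=
  \sum_i u 0 i *: (vbasis (h^C)%VS)`_i.

Lemma vlift_fun_linear : linear vlift_fun.
Proof.
move=> a u v; rewrite /vlift_fun scaler_sumr -big_split.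
by apply: eq_bigr => i _; rewrite !mxE scalerDl scalerA.
Qed.
HB.instance Definition _ :=
  GRing.isLinear.Build F 'rV[F]_N H _ vlift_fun vlift_fun_linear.

(* Identifies ['rV_N] with a complement of [h], hence with [H/h]. *)
Definition vlift : 'Hom('rV[F]_N, H) := linfun vlift_fun.

Lemma vlift_mem u : vlift u \in (h^C)%VS.
Proof.
rewrite lfunE memv_suml // => i _; rewrite memvZ // vbasis_mem //.
by rewrite mem_nth // size_tuple.
Qed.

Lemma lker_vlift : lker vlift == 0%VS.
Proof.
have fr : free (vbasis (h^C)%VS) := basis_free (vbasisP _).
have coordE u i : coord (vbasis (h^C)%VS) i (vlift u) = u 0 i.
  by rewrite lfunE; apply: coord_sum_free.
by apply/lker0P => u v uv; apply/rowP => i; rewrite -!coordE uv.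
Qed.

Lemma vlift_in_h u : (vlift u \in h) = (u == 0).
Proof.
apply/idP/eqP => [uh|->]; last by rewrite linear0 mem0v.
have : vlift u \in (h :&: h^C)%VS by rewrite memv_cap uh vlift_mem.
rewrite capv_compl memv0 => /eqP u0.
by move/lker0P: lker_vlift => inj; apply: inj; rewrite u0 linear0.
Qed.

Definition hull c : {vspace H} := (h + <<map vlift c>>)%VS.

Lemma hull_mem c W j : (hull c <= W)%VS -> vlift (tnth c j) \in W.
Proof.
rewrite subv_add => /andP[_ /span_subvP cW].
by apply: cW; apply: map_f; apply: mem_tnth.
Qed.

Lemma hull_memPn c W : (h <= W)%VS -> ~~ (hull c <= W)%VS ->
  exists j, vlift (tnth c j) \notin W.
Proof.
move=> hW cW; apply/existsP; apply: contraNT cW => /existsPn jW.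
rewrite subv_add hW; apply/span_subvP => _ /mapP[u /tnthP[j ->] ->].
by have := jW j; rewrite negbK.
Qed.

Lemma sub_hull c : (h <= hull c)%VS. Proof. exact: addvSl. Qed.

Lemma dim_hull c : \dim (hull c) = (M + \dim <<c>>)%N.
Proof.
rewrite /hull -limg_span dimv_disjoint_sum.
  by rewrite limg_dim_eq // (eqP lker_vlift) capv0.
apply/eqP; rewrite -subv0; apply/subvP => x /memv_capP[xh /memv_imgP[u _ xu]].
by move: xh; rewrite xu vlift_in_h => /eqP->; rewrite linear0 mem0v.
Qed.

(** A trace form with two uses: for g a transvecting map it indexes the characters by tuples, and
    for g the projection onto y along h it gives the value of the character function at y. *)
Definition pairing (x : 'I_M -> H) (g : 'End(H)) : F :=
  \sum_j coord (vbasis h) j (projv h (g (x j))).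

Lemma pairingBl x1 x2 g :
  pairing (fun j => x1 j - x2 j) g = pairing x1 g - pairing x2 g.
Proof. by rewrite -sumrB; apply: eq_bigr => j _; rewrite !linearB. Qed.

(** If the image of phi lies in the line of the j-th basis vector of h, only the j-th term of the
    pairing survives. *)
Lemma exists_pairing (x : 'I_M -> H) W j a : (h <= W)%VS -> x j \notin W ->
  exists phi, [/\ transvecting h phi, (W <= lker phi)%VS & pairing x phi = a].
Proof.
move=> hW xjW; have bh : a *: (vbasis h)`_j \in h.
  by rewrite memvZ // vbasis_mem // mem_nth // size_tuple.
have [phi [im_phi WW phij]] := exists_lfun (a *: (vbasis h)`_j) xjW.
exists phi; split => //.
  rewrite /transvecting (subv_trans hW WW) andbT.
  exact: subv_trans im_phi bh.
have fr : free (vbasis h) := basis_free (vbasisP h).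
rewrite /pairing (bigD1 j) //= big1 ?addr0 => [|i ij].
  by rewrite phij projv_id // linearZ /= coord_free // eqxx mulr1.
have /(subvP im_phi)/vlineP[k ->] := memv_img phi (memvf (x i)).
rewrite projv_id; last exact: (memvZ k bh).
by rewrite !linearZ /= coord_free // [j == i]eq_sym (negPf ij) !mulr0.
Qed.

Variables (K : fieldType) (psi : F -> K).

(** The pairing evaluates on c the linear map whose graph is y. The value 0 elsewhere is forced: if
    [hull c] is not inside [y + h], some transvection fixes y while its character for c is not 1
    there, so every c-isotypic function vanishes at y. *)
Definition chi c y : K :=
  if (hull c <= y + h)%VS
  then psi (pairing (fun j => vlift (tnth c j)) (daddv_pi y h)) else 0.

Hypothesis psiD : {morph psi : a b / a + b >-> a * b}.

(** The component in y of a vector of z + h already lies in z. So along covers inside the support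
    only the weight in [eigenfun] changes. *)
Lemma chi_sub c y z : (y :&: h = 0)%VS -> (z <= y)%VS ->
  (hull c <= z + h)%VS -> chi c z = chi c y.
Proof.
move=> yh zy cz; have zh : (z :&: h = 0)%VS.
  by apply/eqP; rewrite -subv0 -yh capvS.
have cy : (hull c <= y + h)%VS by apply: subv_trans cz (addvS zy (subvv h)).
rewrite /chi cz cy; congr psi; apply: eq_bigr => j _.
suff -> : daddv_pi z h (vlift (tnth c j)) = daddv_pi y h (vlift (tnth c j)) by
  [].
apply/esym/daddv_piP => //; first by apply: (subvP zy); apply: memv_pi.
exact/daddv_pi_sub/hull_mem.
Qed.

(** Passing from y to its translate adds phi x to the component of x, so the pairing becomes a sum
    and [psi] makes it a product. This is membership in the c-isotypic part. *)
Lemma chi_trans c y phi : (y :&: h = 0)%VS -> transvecting h phi ->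
  chi c ((\1 + phi)%VF @: y) =
  psi (pairing (fun j => vlift (tnth c j)) phi) * chi c y.
Proof.
move=> yh phiP; rewrite /chi trans_add //.
case: ifPn => [cy|_]; last by rewrite mulr0.
rewrite -psiD; congr psi; rewrite -big_split; apply: eq_bigr => j _ /=.
set x := vlift _; have xy : x \in (y + h)%VS.
  exact: hull_mem.
have xh := daddv_pi_sub yh xy.
have -> : phi x = phi (daddv_pi y h x).
  by apply/eqP; rewrite -subr_eq0 -linearB /= (trans_ker phiP xh).
rewrite -!linearD /= [phi _ + _]addrC -(transE phi).
suff -> : daddv_pi ((\1 + phi)%VF @: y) h x = (\1 + phi)%VF (daddv_pi y h x) by
  [].
apply: daddv_piP.
- by apply/eqP; rewrite -dimv_eq0 (trans_cap phiP) // yh dimv0.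
- by apply: memv_img; apply: memv_pi.
by rewrite transE opprD addrA memvB // trans_im.
Qed.

End Characters.

(** * Eigenvectors *)

Section DimensionOfCaps.
Variables (F : fieldType) (H : vectType F).
Implicit Types (U y z : {vspace H}).

Lemma dim_cap_sub U y z : (z <= y)%VS -> \dim y = (\dim z).+1 ->
  (\dim (z :&: U) + ~~ (y :&: U <= z)%VS = \dim (y :&: U))%N.
Proof.
move=> zy dy; have [yUz|yUz] := boolP (y :&: U <= z)%VS.
  rewrite addn0; congr (\dim _); apply/eqP; rewrite eqEsubv capvS //=.
  by rewrite subv_cap yUz capvSr.
have zE : (z :&: U = z :&: (y :&: U))%VS.
  by rewrite capvA (capv_idPl zy).
have yE : \dim (z + (y :&: U)) = \dim y.
  have le1 : (z + (y :&: U) <= y)%VS by rewrite subv_add zy capvSl.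
  apply/eqP; rewrite eqn_leq dimvS // dy ltn_neqAle dimvS ?addvSl // andbT.
  by rewrite (dimv_leqif_sup (addvSl _ _)) subv_add subvv.
have := dimv_sum_cap z (y :&: U)%VS.
rewrite zE yE dy /=; lia.
Qed.

Lemma dim_cap_sup U y z : (y <= z)%VS -> \dim z = (\dim y).+1 ->
  \dim (z :&: U) = (\dim (y :&: U) + (z <= y + U)%VS)%N.
Proof.
move=> yz dz; have := dimv_sum_cap z U; have := dimv_sum_cap y U.
have sub : (y + U <= z + U)%VS by apply: addvS.
have [zU|zU] := boolP (z <= y + U)%VS.
  have -> : (z + U = y + U)%VS.
    by apply/eqP; rewrite eqEsubv sub subv_add zU addvSr.
  rewrite dz /=; lia.
have : (\dim (y + U) < \dim (z + U))%N.
  rewrite ltn_neqAle dimvS // andbT (dimv_leqif_sup sub) subv_add negb_and.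
  by rewrite zU.
have : (\dim (y :&: U) <= \dim (z :&: U))%N by rewrite dimvS // capvS.
rewrite dz /=; lia.
Qed.

End DimensionOfCaps.

Section CoverCounts.
Variables (F : finFieldType) (H : vectType F) (h : {vspace H}).
Variable K : numFieldType.
Local Notation X := (attenuated h).
Local Notation q := (#|F|%:R : K).
Implicit Types (y z : X) (U W : {vspace H}).

Lemma attenuated_cap y : (val y :&: h = 0)%VS.
Proof. exact/eqP/(valP y). Qed.

Lemma dim_attenuated_add y : \dim (val y + h) = (\dim (val y) + \dim h)%N.
Proof. by rewrite dimv_disjoint_sum // attenuated_cap. Qed.

Lemma card_attenuated (P : pred {vspace H}) :
  #|[set z : X | P (val z)]| = #|[set W | (W :&: h == 0)%VS & P W]|.
Proof.
rewrite -(card_imset _ val_inj); apply: eq_card => W; rewrite inE.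
apply/imsetP/andP => [[z] | [Wh PW]].
  by rewrite inE => Pz ->; rewrite (valP z).
by exists (Sub W Wh); rewrite ?inE SubK.
Qed.

Lemma card_covered y W : (W <= val y)%VS ->
  #|[set z : X | covers y z & (W <= val z)%VS]|%:R =
  (q ^+ (\dim (val y) - \dim W) - 1) / (q - 1).
Proof.
move=> Wy; have q1 := card_finField_gt1 F K.
rewrite (card_attenuated (fun z : {vspace H} => ((z <= val y)%VS
           && (\dim (val y) == (\dim z).+1)) && (W <= z)%VS)).
have [dWy|dWy] := eqVneq (\dim W) (\dim (val y)).
  rewrite dWy subnn subrr mul0r (_ : [set _ | _] = set0) ?cards0 //.
  apply/setP => z; rewrite !inE; apply/negP.
  by case/and3P => _ /andP[zy /eqP dz] /dimvS; rewrite dWy dz ltnn.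
have {dWy}dWy : (\dim W < \dim (val y))%N by rewrite ltn_neqAle dWy dimvS.
pose m := (\dim (val y) - \dim W).-1.
have mE : (\dim (val y) - \dim W = m.+1)%N by rewrite /m; lia.
rewrite mE -gbinSn // -mE -card_interval //; congr (_%:R); apply: eq_card => z.
rewrite !inE; apply/and3P/andP.
  case=> zh /andP[zy /eqP dz] Wz; rewrite Wz zy; split => //.
  by apply/eqP; lia.
case=> /andP[Wz zy] /eqP dz; split => //.
  by rewrite -subv0 -(attenuated_cap y) capvS.
by rewrite zy; apply/eqP; lia.
Qed.

Lemma cover_meets_h y (z : {vspace H}) :
  (val y <= z)%VS -> \dim z = (\dim (val y)).+1 ->
  (z :&: h == 0)%VS = ~~ (z <= val y + h)%VS.
Proof.
move=> yz dz; rewrite -dimv_eq0 (dim_cap_sup _ yz dz) attenuated_cap dimv0.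
by case: (z <= _)%VS.
Qed.

(** Of the subspaces one dimension above y, those that meet h nontrivially are the ones inside y +
    h, so the count is a difference of two intervals. *)
Lemma card_covering y W : (val y + h <= W)%VS ->
  #|[set z : X | covers z y & (val z <= W)%VS]|%:R =
  (q ^+ (\dim W - \dim (val y)) - q ^+ \dim h) / (q - 1).
Proof.
move=> yhW; have q1 := card_finField_gt1 F K.
have yW : (val y <= W)%VS := subv_trans (addvSl _ _) yhW.
rewrite (card_attenuated (fun z : {vspace H} => ((val y <= z)%VS
           && (\dim z == (\dim (val y)).+1)) && (z <= W)%VS)).
have -> : [set z : {vspace H} | (z :&: h == 0)%VS &
   ((val y <= z)%VS && (\dim z == (\dim (val y)).+1)) && (z <= W)%VS] =
   interval (val y) W 1 :\: interval (val y) (val y + h)%VS 1.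
  apply/setP => z; rewrite !inE addn1.
  have [yz|] := boolP (val y <= z)%VS; last by rewrite !andbF.
  have [dz|] := eqVneq (\dim z) (\dim (val y)).+1; last by rewrite !andbF.
  by rewrite (cover_meets_h yz dz) /= !andbT.
have sub : interval (val y) (val y + h)%VS 1 \subset interval (val y) W 1.
  apply/subsetP => z; rewrite !inE => /andP[/andP[-> zyh] ->].
  by rewrite (subv_trans zyh yhW).
rewrite cardsDS // natrB ?subset_leq_card // !card_interval ?addvSl //.
rewrite dim_attenuated_add addKn !gbinn1 -mulrBl; congr (_ / _).
by rewrite opprB addrA subrK.
Qed.

End CoverCounts.

Lemma sum_if (K : pzRingType) (T : finType) (P b : pred T) (x1 x0 : K) :
  \sum_(z | P z) (if b z then x1 else x0) =
  #|[set z | P z & b z]|%:R * x1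
    + (#|[set z | P z]|%:R - #|[set z | P z & b z]|%:R) * x0.
Proof.
have cardE (A : pred T) (x : K) : \sum_(z | A z) x = #|[set z | A z]|%:R * x.
  by rewrite -big_set sumr_const mulr_natl.
rewrite (bigID b) /= !(eq_bigr _ (fun _ _ => erefl)).
rewrite (eq_bigr (fun _ => x1)) => [|z /andP[_ ->] //].
rewrite [X in _ + X](eq_bigr (fun _ => x0)) => [|z /andP[_ /negPf->] //].
rewrite !cardE; congr (_ + _ * _); apply/eqP; rewrite eq_sym subr_eq -natrD.
rewrite addnC -(cardsID [set z | b z] [set z | P z]) eq_sym.
apply/eqP; congr (_%:R); congr addn; apply: eq_card => z; rewrite !inE //.
by rewrite andbC.
Qed.

(** With w = dim y, t = dim (y cap U), u = dim U and f = dim H, the new parameters are w - t, t -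
    rho, u - M - t and f - u. They replace truncated differences by sums, so that [field] can treat
    the powers of q as independent unknowns. *)
Lemma split_exponents (f u w t rho M yU : nat) :
  (t <= w)%N -> (rho <= t)%N -> (w + M <= yU)%N -> (w + M <= f)%N ->
  (u <= f)%N -> (yU + t = w + u)%N -> exists al be ga de : nat,
  [/\ w - t = al, w - rho = al + be, yU - w = ga + M & u - M - rho = be + ga]%N
  /\ [/\ f - M - (u - M) = de, w = rho + be + al &
         w + (f - w) = rho + be + ga + de + M]%N.
Proof.
move=> ? ? ? ? ? ?.
exists (w - t)%N, (t - rho)%N, (u - M - t)%N, (f - u)%N; do 2!split; lia.
Qed.

Section Eigenvectors.
Variables (F : finFieldType) (H : vectType F) (h : {vspace H}).
Variables (K : numFieldType) (psi : F -> K) (r : K).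
Local Notation X := (attenuated h).
Local Notation q := (#|F|%:R : K).
Local Notation M := (\dim h).
Local Notation N := (\dim (h^C)%VS).
Implicit Types (y z : X) (U W : {vspace H}) (c : M.-tuple 'rV[F]_N).
Hypothesis psiD : {morph psi : a b / a + b >-> a * b}.
Hypothesis psi_nontriv : exists a, psi a != 1.
Hypothesis r_sqr : r ^+ 2 = q.

Definition transX (phi : 'End(H)) y : X := insubd y ((\1 + phi)%VF @: val y)%VS.

Lemma val_transX phi y : transvecting h phi ->
  val (transX phi y) = ((\1 + phi)%VF @: val y)%VS.
Proof.
move=> phiP; rewrite val_insubd ifT // -dimv_eq0.
by rewrite (trans_cap phiP) // attenuated_cap dimv0.
Qed.

Lemma transX_inj phi : transvecting h phi -> injective (transX phi).
Proof.
move=> phiP y z /(congr1 val); rewrite !val_transX // => /eqP.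
by rewrite eq_limg_ker0 ?(trans_ker0 phiP) // => /eqP/val_inj.
Qed.

Definition weight c U (w t : nat) : K :=
  let Q := q ^+ (\dim U - M - \dim <<c>>) in
  (- Q) ^+ t / (r ^+ (M + \dim <<c>>) * Q) ^+ w.

Definition eigenfun c U y : K :=
  chi psi c (val y) * weight c U (\dim (val y)) (\dim (val y :&: U)).

Lemma eigenfun_trans c U y phi : (h <= U)%VS -> transvecting h phi ->
  eigenfun c U (transX phi y) =
  psi (pairing (fun j => vlift h (tnth c j)) phi) * eigenfun c U y.
Proof.
move=> hU phiP; rewrite /eigenfun val_transX // chi_trans ?attenuated_cap //.
by rewrite (trans_dim phiP) (trans_cap phiP) // -mulrA.
Qed.

(* A transvection fixing [val y + h] pointwise permutes the covers of [y] and
   multiplies the sum by a value of [psi] other than 1. *)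
Lemma sum_covering_eq0 c U y : (h <= U)%VS -> ~~ (hull c <= val y + h)%VS ->
  \sum_(z | covers z y) eigenfun c U z = 0.
Proof.
move=> hU cy; have [j jy] := hull_memPn (addvSr (val y) h) cy;
  have [a a1] := psi_nontriv.
have [phi [phiP /subvP ker_phi phia]] :=
  @exists_pairing _ _ _ (fun i =>
    vlift h (tnth c i)) _ _ a (addvSr (val y) h) jy.
have trans_y z : covers (transX phi z) y = covers z y.
  rewrite /covers val_transX // (trans_dim phiP); congr (_ && _).
  rewrite -(limg_ker0 (val y) (val z) (trans_ker0 phiP)); congr (_ <= _)%VS.
  apply/esym; rewrite -[RHS]lim1g; apply: eq_in_limg => x xy.
  rewrite transE id_lfunE; suff /eqP -> : phi x == 0 by rewrite addr0.
  by rewrite -memv_ker ker_phi // (subvP (addvSl _ _)).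
set S := \sum_(z | _) _; suff : S = psi a * S.
  move/eqP; rewrite -subr_eq0 -{1}[S]mul1r -mulrBl mulf_eq0 subr_eq0.
  by rewrite eq_sym (negPf a1) => /eqP.
rewrite {1}/S (reindex_inj (transX_inj phiP)) mulr_sumr.
by apply: eq_big => z; [exact: trans_y | rewrite eigenfun_trans // phia].
Qed.

Definition eigenval (rho k : nat) : K :=
  r ^+ (M + rho) * (q ^+ (N - k) - q ^+ (k - rho)) / (q - 1).

(* If [hull c <= val y + h], a cover [z] of [y] changes [\dim (val z :&: U)] iff
   [val z <= val y + U], and an element [z] covered by [y] changes it iff
   [val y :&: U] is not below [val z]; both cases are counted as intervals. *)
Lemma eigenfunP c U y : (hull c <= U)%VS ->
  \sum_(z | covers y z) eigenfun c U z
    + q ^+ \dim (val y) * \sum_(z | covers z y) eigenfun c U z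
  = eigenval (\dim <<c>>) (\dim U - M) * eigenfun c U y.
Proof.
move=> cU; have hU : (h <= U)%VS := subv_trans (sub_hull c) cU.
have yh := attenuated_cap y.
have [cy|cy] := boolP (hull c <= val y + h)%VS; last first.
  rewrite sum_covering_eq0 // mulr0 addr0 big1 => [|z /andP[zy _]].
    by rewrite /eigenfun /chi (negPf cy) !mul0r mulr0.
  rewrite /eigenfun /chi ifN ?mul0r //; apply: contraNN cy => cz.
  exact: subv_trans cz (addvS zy (subvv h)).
pose rho := \dim <<c>>; pose w := \dim (val y); pose t := \dim (val y :&: U).
have q1 := card_finField_gt1 F K; have q0 := q_neq0 q1.
have q10 : q - 1 != 0 by have := qX_neq1 q1 0; rewrite expr1.
have r0 : r != 0 by apply: contraNneq q0 => r0; rewrite -r_sqr r0 expr0n.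
pose Q := q ^+ (\dim U - M - rho); pose s := r ^+ (M + rho).
have Q0 : Q != 0 by rewrite expf_neq0.
have s0 : s != 0 by rewrite expf_neq0.
have sQ0 n : (s * Q) ^+ n != 0 by rewrite expf_neq0 // mulf_neq0.
have down z : covers y z -> eigenfun c U z =
   if (val y :&: hull c <= val z)%VS then
     eigenfun c U y * (if (val y :&: U <= val z)%VS then s * Q else - s)
   else 0.
  case/andP => zy /eqP dy.
  have czE : (hull c <= val z + h)%VS = (val y :&: hull c <= val z)%VS.
    apply/idP/idP => [cz|yz].
      apply: subv_trans (_ : val y :&: (val z + h) <= val z)%VS.
        by rewrite subv_cap capvSl (subv_trans (capvSr _ _)).
      by rewrite capvC -vspace_modl // [(h :&: _)%VS]capvC yh addv0.
    rewrite -(capv_idPr cy) [(_ + h)%VS]addvC -vspace_modl ?sub_hull //.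
    by rewrite subv_add addvSr (subv_trans yz) ?addvSl.
  have dE := dim_cap_sub U zy dy.
  case: ifPn => [yz|cz]; last first.
    by rewrite /eigenfun /chi czE (negPf cz) mul0r.
  rewrite /eigenfun (@chi_sub _ _ _ _ _ c (val y) (val z)) ?czE //.
  rewrite -mulrA; congr (_ * _); rewrite /weight -/rho -/Q -/s dy -dE.
  case: ifP => _; rewrite ?addn0 ?addn1 /= ?exprS.
    by field; rewrite sQ0 Q0 s0.
  by field; rewrite sQ0 Q0 s0.
have up z : covers z y -> eigenfun c U z =
    eigenfun c U y * (if (val z <= val y + U)%VS then - s^-1 else (s * Q)^-1).
  case/andP => yz /eqP dz; have dE := dim_cap_sup U yz dz.
  rewrite /eigenfun -(@chi_sub _ _ _ _ _ c (val z) (val y)) ?attenuated_cap //.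
  rewrite -mulrA; congr (_ * _); rewrite /weight -/rho -/Q -/s dz dE.
  case: ifP => _; rewrite ?addn0 ?addn1 /= ?exprS.
    by field; rewrite sQ0 Q0 s0.
  by field; rewrite sQ0 Q0 s0.
have dim_hull_y : \dim (val y :&: hull c) = rho.
  have := dimv_sum_cap (val y) (hull c); rewrite dim_hull -/w -/rho.
  have -> : (val y + hull c = val y + h)%VS.
    apply/eqP; rewrite eqEsubv; apply/andP; split; rewrite subv_add addvSl //.
    exact: subv_trans (sub_hull c) (addvSr _ _).
  by rewrite dim_attenuated_add -addnA => /addnI/addnI.
have dim_U_y := dimv_sum_cap (val y) U.
rewrite (eq_bigr _ down) (eq_bigr _ up) -big_mkcondr -!mulr_sumr !sum_if /=.
have -> : [set z : X | covers y z && (val y :&: hull c <= val z)%VS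
    & (val y :&: U <= val z)%VS] =
   [set z : X | covers y z & (val y :&: U <= val z)%VS].
  apply/setP => z; rewrite !inE -andbA; congr (_ && _).
  by rewrite andb_idl // => /(subv_trans _) -> //; apply: capvS.
have -> : [set z | covers z y] = [set z : X | covers z y & (val z <= fullv)%VS].
  by apply/setP => z; rewrite !inE subvf andbT.
rewrite !card_covered ?capvSl // !card_covering ?subvf ?addvS //.
have le_tw : (t <= w)%N by rewrite dimvS ?capvSl.
have le_rt : (rho <= t)%N by rewrite -dim_hull_y dimvS ?capvS.
have le_yU : (w + M <= \dim (val y + U))%N.
  by rewrite -dim_attenuated_add dimvS ?addvS.
have le_yf : (w + M <= \dim (fullv : {vspace H}))%N.
  by rewrite -dim_attenuated_add dimvS ?subvf.
have le_Uf : (\dim U <= \dim (fullv : {vspace H}))%N by rewrite dimvS ?subvf.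
have NE : N = (\dim (fullv : {vspace H}) - M)%N by rewrite dimv_compl.
rewrite -/w -/t in dim_U_y *; rewrite dim_hull_y /eigenval -/rho -/s -/Q NE.
have [al [be [ga [de [[-> -> -> bgE] [-> wE wfE]]]]]] :=
  split_exponents le_tw le_rt le_yU le_yf le_Uf dim_U_y.
have {bgE}QE : Q = q ^+ (be + ga) by rewrite /Q bgE.
have {wfE}fE := congr1 (fun n => q ^+ n) wfE.
have {}wE : q ^+ w = q ^+ (rho + be + al) by rewrite -wE.
rewrite exprD in fE.
(* Since s^2 = q^(M + rho), removing the inverse of s leaves on both sides s times an expression in
   integral powers of q. *)
have sV : s^-1 = s / (q ^+ M * q ^+ rho).
  by rewrite -exprD -r_sqr -exprM mulnC exprM -/s; field; rewrite s0.
have qX0 n : q ^+ n != 0 by rewrite expf_neq0.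
rewrite [X in _ + X = _]mulrCA -mulrDr mulrC; congr (_ * _).
rewrite invfM.
set f := q ^+ (_ - w) in fE *.
have -> : q ^+ w * ((q ^+ (ga + M) - q ^+ M) / (q - 1) * - s^-1
   + ((f - q ^+ M) / (q - 1) - (q ^+ (ga + M) - q ^+ M) / (q - 1))
       * (s^-1 * Q^-1)) =
  (- q ^+ w * (q ^+ (ga + M) - q ^+ M) + (q ^+ w * f - q ^+ w * q ^+ (ga + M))
    / Q)
    * s^-1 / (q - 1) by field; rewrite Q0 s0 q10.
rewrite fE wE sV QE !exprD.
have := (s0, q10, qX0 al, qX0 be, qX0 ga, qX0 de, qX0 M, qX0 rho).
generalize (q ^+ al), (q ^+ be), (q ^+ ga), (q ^+ de), (q ^+ M), (q ^+ rho).
generalize s, q; clear=> s1 x A B C D m P [[[[[[[s1n x1] A0] B0] C0] D0] m0]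
  P0].
by field; rewrite x1 B0 C0 m0 P0.
Qed.

End Eigenvectors.

(** * Linear independence *)

Section Moebius.
Variables (F : finFieldType) (H : vectType F) (K : numFieldType).
Local Notation q := (#|F|%:R : K).
Implicit Types (T U W Z : {vspace H}).

(** The q-binomial theorem with each Gaussian binomial opened up into the subspaces that it
    counts. *)
Lemma expr_dim_interval (x : K) Z T : (Z <= T)%VS ->
  x ^+ (\dim T - \dim Z) =
  \sum_(W : {vspace H} | (Z <= W <= T)%VS)
     \prod_(j < \dim W - \dim Z) (x - q ^+ j).
Proof.
move=> ZT; rewrite (q_binomial_theorem (card_finField_gt1 F K)).
have dimW W : (Z <= W <= T)%VS ->
    (\dim W - \dim Z < (\dim T - \dim Z).+1)%N.
  by case/andP => _ WT; rewrite ltnS leq_sub2r // dimvS.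
rewrite (partition_big (fun W => inord (\dim W - \dim Z))
           (fun _ : 'I_(\dim T - \dim Z).+1 => true)) //=.
apply: eq_bigr => m _; rewrite -card_interval // mulr_natl -sumr_const.
apply: eq_big => [W|W].
  rewrite inE; have [ZWT|] //= := boolP (_ <= W <= _)%VS.
  rewrite -val_eqE /= inordK ?dimW //.
  case/andP: ZWT => /dimvS ZW _; rewrite -(eqn_add2l (\dim Z)) subnKC //.
by rewrite inE => /andP[_ /eqP->]; rewrite addKn.
Qed.

(* By the q-binomial theorem the coefficients of the Moebius inversion are
   products of factors [x - q ^+ j], so they do not vanish. *)
Lemma interval_sums_eq0 (x : K) Z (d : nat) (f : {vspace H} -> K) :
  (forall j, x - q ^+ j != 0) ->
  (forall W, (Z <= W)%VS ->
     \sum_(U : {vspace H} | (Z <= U)%VS && (\dim U == d))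
        f U * x ^+ (\dim (W :&: U) - \dim Z) = 0) ->
  forall U, (Z <= U)%VS -> \dim U = d -> f U = 0.
Proof.
move=> xq sum0 U0 ZU0 dU0.
(* [g] vanishes by induction on dim W, and [g U0] has the single summand [f U0] because all U in the
   sum have the dimension of U0. *)
pose g W := \sum_(U : {vspace H} | [&& (Z <= U)%VS, \dim U == d & (W <= U)%VS])
  f U.
have sum_g W : (Z <= W)%VS -> \sum_(T : {vspace H} | (Z <= T <= W)%VS)
     (\prod_(j < \dim T - \dim Z) (x - q ^+ j)) * g T = 0.
  move=> ZW; rewrite -{}[RHS](sum0 W ZW).
  under [RHS]eq_bigr => U /andP[ZU _].
    rewrite expr_dim_interval ?subv_cap ?ZW // mulr_sumr; over.
  under [LHS]eq_bigr => T _ do rewrite /g mulr_sumr.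
  rewrite (exchange_big_dep (fun U => (Z <= U)%VS && (\dim U == d))) /=.
    apply: eq_bigr => U /andP[ZU dU]; apply: eq_big => [T|T _].
      by rewrite ZU dU /= subv_cap andbA.
    by rewrite mulrC.
  by move=> T U _ /and3P[-> ->].
have g0 n W : (Z <= W)%VS -> (\dim W < n)%N -> g W = 0.
  elim: n W => // n IHn W ZW; rewrite ltnS => dW; have := sum_g W ZW.
  rewrite (bigD1 W) ?ZW ?subvv //=.
  rewrite [X in _ + X]big1 => [|T /andP[/andP[ZT TW] TnW]]; last first.
    rewrite IHn ?mulr0 //; apply: leq_trans dW.
    by rewrite ltn_neqAle dimvS // andbT (dimv_leqif_eq TW).
  rewrite addr0 => /eqP; rewrite mulf_eq0 => /orP[/prodf_eq0[j _] | /eqP//].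
  by rewrite (negPf (xq j)).
have := g0 _ U0 ZU0 (ltnSn _); rewrite /g (bigD1 U0) /=; last first.
  by rewrite ZU0 dU0 subvv eqxx.
rewrite big1 ?addr0 // => U /andP[/and3P[_ /eqP dU U0U]].
by rewrite eq_sym -(dimv_leqif_eq U0U) dU dU0 eqxx.
Qed.

End Moebius.

Section SimultaneousDiagonalization.
Variables (K : fieldType) (n m : nat) (P : 'M[K]_(n, m)).
Implicit Types d : 'I_m -> K.

(** Multiplying the coefficients of a linear relation among the columns by such a d gives a relation
    again ([diagonalized_mul]). These d are closed under products and under passing to the indicator
    of a value, so joint eigenspaces can be cut out before the columns are known to be
    independent. *)
Definition diagonalized d :=
  exists E : 'M[K]_n, forall j, E *m col j P = d j *: col j P.

Lemma diagonalized_eq d lam : diagonalized d ->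
  diagonalized (fun j => (d j == lam)%:R).
Proof.
case=> A AP; have [E [E1 E0]] := primitive_idempotent_exists A lam.
exists E => j; have [dj|dj] := eqVneq (d j) lam.
  by rewrite scale1r E1 // -dj.
by rewrite scale0r; apply: (E0 (d j)).
Qed.

Lemma diagonalizedM d1 d2 : diagonalized d1 -> diagonalized d2 ->
  diagonalized (fun j => d1 j * d2 j).
Proof.
move=> [A1 A1P] [A2 A2P]; exists (A1 *m A2) => j.
by rewrite -mulmxA A2P -scalemxAr A1P scalerA mulrC.
Qed.

Lemma diagonalized_prod (I : finType) (d : I -> 'I_m -> K) :
  (forall i, diagonalized (d i)) -> diagonalized (fun j => \prod_i d i j).
Proof.
move=> dP; suff [E EP] : diagonalized (fun j => \prod_(i <- enum I) d i j).
  by exists E => j; rewrite EP big_enum.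
elim: (enum I) => [|i s IHs].
  by exists 1%:M => j; rewrite mul1mx big_nil scale1r.
have [E EP] := diagonalizedM (dP i) IHs.
by exists E => j; rewrite big_cons EP.
Qed.

Lemma diagonalized_mul d (a : 'I_m -> K) : diagonalized d ->
  \sum_j a j *: col j P = 0 -> \sum_j (d j * a j) *: col j P = 0.
Proof.
case=> E EP /(congr1 (mulmx E)); rewrite mulmx0 mulmx_sumr => Pa0.
by rewrite -[RHS]Pa0; apply: eq_bigr => j _;
  rewrite -scalemxAr EP scalerA mulrC.
Qed.

End SimultaneousDiagonalization.

Section Independence.
Variables (F : finFieldType) (H : vectType F) (h : {vspace H}).
Variables (K : numFieldType) (psi : F -> K) (r : K).
Local Notation X := (attenuated h).
Local Notation q := (#|F|%:R : K).
Local Notation M := (\dim h).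
Local Notation N := (\dim (h^C)%VS).
Implicit Types (y z : X) (U W : {vspace H}) (c : M.-tuple 'rV[F]_N).
Hypothesis psiD : {morph psi : a b / a + b >-> a * b}.
Hypothesis psi0 : psi 0 = 1.
Hypothesis psi_nontriv : exists a, psi a != 1.
Hypothesis r_sqr : r ^+ 2 = q.

Definition pairs := [set p : M.-tuple 'rV[F]_N * {vspace H} | (hull p.1 <=
  p.2)%VS].
Local Notation Y := pairs.

Definition eigenmx : 'M[K]_(#|X|, #|Y|) :=
  \matrix_(i, j) eigenfun psi r (enum_val j).1 (enum_val j).2 (enum_val i).

Definition pair_eigenval (p : M.-tuple 'rV[F]_N * {vspace H}) : K :=
  eigenval h r (\dim <<p.1>>) (\dim p.2 - M).

Lemma eigenval_inj rho k1 k2 : (rho <= k1 <= N)%N -> (rho <= k2 <= N)%N ->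
  eigenval h r rho k1 = eigenval h r rho k2 -> k1 = k2.
Proof.
have q1 := card_finField_gt1 F K; have q0 := q_neq0 q1.
have q10 : q - 1 != 0 by have := qX_neq1 q1 0; rewrite expr1.
have r0 : r != 0 by apply: contraNneq q0 => r0; rewrite -r_sqr r0 expr0n.
have lt k l : (rho <= k <= N)%N -> (rho <= l <= N)%N -> (k < l)%N ->
    q ^+ (N - l) - q ^+ (l - rho) < q ^+ (N - k) - q ^+ (k - rho).
  move=> /andP[? ?] /andP[? ?] kl; apply: ltrB; rewrite ltr_eXn2l //; lia.
move=> k1P k2P /(divIf q10) /mulfI; rewrite expf_neq0 // => /(_ isT) eq12.
case: (ltngtP k1 k2) => // kl.
  by have := lt _ _ k1P k2P kl; rewrite eq12 ltxx.
by have := lt _ _ k2P k1P kl; rewrite eq12 ltxx.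
Qed.

(** For each W above [hull c] the relation is tested at a complement y of h in W. There dim (y cap
    U) = dim (W cap U) - M, so up to a common nonzero factor the values are powers of -Q, and
    [interval_sums_eq0] applies with x = -Q. *)
Lemma sum_same_dim_eq0 c (d : nat) (f : {vspace H} -> K) :
  (forall y, \sum_(U : {vspace H} | (hull c <= U)%VS && (\dim U == d))
               f U * eigenfun psi r c U y = 0) ->
  forall U, (hull c <= U)%VS -> \dim U = d -> f U = 0.
Proof.
have q1 := card_finField_gt1 F K; have q0 := q_neq0 q1.
have r0 : r != 0 by apply: contraNneq q0 => r0; rewrite -r_sqr r0 expr0n.
have psi_neq0 a : psi a != 0.
  apply: contraTneq (oner_neq0 K) => psia.
  by rewrite -psi0 -(subrr a) psiD psia mul0r eqxx.
pose Q := q ^+ (d - M - \dim <<c>>).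
move=> sum0; apply: (@interval_sums_eq0 _ _ _ (- Q)) => [j | W cW].
  by rewrite -opprD oppr_eq0 gt_eqF // addr_gt0 // exprn_gt0 // (lt_trans
    ltr01).
have hW : (h <= W)%VS := subv_trans (sub_hull c) cW.
have yh : ((W :\: h)%VS :&: h == 0)%VS by rewrite capv_diff.
have yW : (W :\: h + h)%VS = W by rewrite addv_diff; apply/addv_idPl.
pose y : X := Sub (W :\: h)%VS yh; have yE : val y = (W :\: h)%VS by [].
have := sum0 y; rewrite /eigenfun /chi yE yW cW.
set e := psi _; set w := \dim (W :\: h).
pose u := e * (- Q) ^+ \dim <<c>> / (r ^+ (M + \dim <<c>>) * Q) ^+ w.
have u0 : u != 0.
  by rewrite !mulf_neq0 ?psi_neq0 ?invr_eq0 ?expf_neq0 ?oppr_eq0 ?mulf_neq0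
             ?expf_neq0.
rewrite (eq_bigr (fun U => f U * (- Q) ^+ (\dim (W :&: U) - \dim (hull c)) *
  u)).
  by rewrite -mulr_suml => /eqP; rewrite mulf_eq0 (negPf u0) orbF => /eqP.
move=> U /andP[cU /eqP dU]; rewrite -mulrA; congr (_ * _).
have hU : (h <= U)%VS := subv_trans (sub_hull c) cU.
have WU : \dim (W :&: U) = (M + \dim ((W :\: h) :&: U))%N.
  rewrite -{1}yW [(_ + h)%VS]addvC -vspace_modl // dimv_disjoint_sum //.
  by rewrite capvA [(h :&: _)%VS]capvC capv_diff cap0v.
have le : (\dim (hull c) <= \dim (W :&: U))%N by rewrite dimvS // subv_cap cW.
rewrite dim_hull WU leq_add2l in le.
rewrite /weight dU -/Q dim_hull WU subnDl /u -{1}(subnK le) exprD.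
by rewrite -!mulrA mulrCA.
Qed.

Lemma diagonalized_trans phi : transvecting h phi ->
  diagonalized eigenmx
    (fun j => psi (pairing (fun i => vlift h (tnth (enum_val j).1 i)) phi)).
Proof.
move=> phiP.
exists (\matrix_(i, k) (enum_val k == transX phi (enum_val i))%:R) => j.
apply/colP => i; rewrite !mxE.
rewrite (bigD1 (enum_rank (transX phi (enum_val i)))) //= big1 => [|k].
  rewrite !mxE enum_rankK eqxx mul1r addr0 eigenfun_trans //.
  have := enum_valP j; rewrite inE; exact: subv_trans (sub_hull _).
by rewrite !mxE -(inj_eq enum_val_inj) enum_rankK => /negPf->; rewrite mul0r.
Qed.

Lemma exists_separating c0 c : exists phi, transvecting h phi /\
  (c != c0 -> psi (pairing (fun i => vlift h (tnth c i)) phi)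
           != psi (pairing (fun i => vlift h (tnth c0 i)) phi)).
Proof.
have [->|cc0] := eqVneq c c0.
  (* A default, so that a map can be chosen for every c at once. *)
  exists 0; split => //; apply/andP; split.
    by apply/subvP => _ /memv_imgP[x _ ->]; rewrite zero_lfunE mem0v.
  by apply/subvP => x _; rewrite memv_ker zero_lfunE.
have [i ci] : exists i, tnth c i != tnth c0 i.
  apply/existsP; rewrite -negb_forall; apply: contraNN cc0 => /forallP cc0.
  by apply/eqP/eq_from_tnth => i; apply/eqP.
have [a a1] := psi_nontriv.
have ch : vlift h (tnth c i) - vlift h (tnth c0 i) \notin h.
  by rewrite -linearB vlift_in_h subr_eq0.
have [phi [phiP _ phia]] := @exists_pairing _ _ _
  (fun i => vlift h (tnth c i) - vlift h (tnth c0 i)) _ _ a (subvv h) ch.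
exists phi; split => // _; apply: contraNneq a1 => eqpsi.
rewrite -phia pairingBl psiD eqpsi -psiD addrN.
by rewrite psi0.
Qed.

Lemma dim_pairs p : p \in Y ->
  (\dim <<p.1>> <= \dim p.2 - M <= N)%N /\ (M <= \dim p.2)%N.
Proof.
have le_N U : (\dim U - M <= N)%N by rewrite dimv_compl leq_sub2r // dimvS
  ?subvf.
rewrite inE => /dimvS; rewrite dim_hull => le; rewrite le_N andbT.
have leM : (M <= \dim p.2)%N := leq_trans (leq_addr _ _) le.
by rewrite -(leq_add2l M) subnKC.
Qed.

(* The operators [A] and the transvections are diagonal on the columns, and
   their joint eigenvalues determine [c] and [\dim U]; so it suffices to treat
   the columns with [c] and [\dim U] fixed. *)
Lemma eigenmx_free (a : 'I_#|Y| -> K) :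
  diagonalized eigenmx (fun j => pair_eigenval (enum_val j)) ->
  \sum_j a j *: col j eigenmx = 0 -> forall j, a j = 0.
Proof.
move=> diagA suma0 j0; set p0 := enum_val j0.
have p0Y : p0 \in Y := enum_valP j0.
have [phi phiP] := fin_all_exists (exists_separating p0.1).
pose d p := (pair_eigenval p == pair_eigenval p0)%:R *
  \prod_c (psi (pairing (fun i => vlift h (tnth p.1 i)) (phi c)) ==
           psi (pairing (fun i => vlift h (tnth p0.1 i)) (phi c)))%:R : K.
have diag_d : diagonalized eigenmx (fun j => d (enum_val j)).
  apply: diagonalizedM; first exact: diagonalized_eq.
  apply: diagonalized_prod => c; apply: diagonalized_eq.
  by apply: diagonalized_trans; case: (phiP c).
have dE p : p \in Y -> d p = ((p.1 == p0.1) && (\dim p.2 == \dim p0.2))%:R.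
  rewrite /d; have [p1 pY|p1 _] /= := eqVneq p.1 p0.1; last first.
    have [_ /(_ p1)/negPf sep] := phiP p.1.
    by rewrite (bigD1 p.1) //= sep mul0r mulr0.
  rewrite big1 ?mulr1 => [|c _]; last by rewrite p1 eqxx.
  congr (_%:R); congr nat_of_bool; rewrite /pair_eigenval p1.
  have := dim_pairs p0Y; have := dim_pairs pY; rewrite p1 => -[pd lp] [p0d lp0].
  apply/eqP/eqP => [/(eigenval_inj pd p0d) dd|-> //].
  by rewrite -(subnK lp) dd subnK.
pose al p := a (enum_rank_in p0Y p).
have alE : al p0 = a j0.
  by rewrite /al /p0 enum_valK_in.
rewrite -alE {alE}.
pose c0 := p0.1; pose U0 := p0.2.
have E0 : p0 = (c0, U0) by apply: surjective_pairing.
have cU0 : (hull c0 <= U0)%VS by have := p0Y; rewrite inE.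
rewrite E0.
apply: (@sum_same_dim_eq0 c0 (\dim U0) (fun U => al (c0, U))) => // y.
have /colP/(_ (enum_rank y)) := diagonalized_mul diag_d suma0.
rewrite summxE mxE => sum0; rewrite -{}[RHS]sum0.
transitivity (\sum_(p in Y) d p * al p * eigenfun psi r p.1 p.2 y).
  rewrite [RHS]big_mkcond [RHS](bigID (fun p => p.1 == c0)) /=.
  rewrite [X in _ + X]big1 ?addr0 => [|p pc].
    rewrite (reindex_onto (fun U => (c0, U)) snd) /=; last first.
      by move=> [c U] /= /eqP->.
    rewrite big_mkcond [RHS]big_mkcond; apply: eq_bigr => U _ /=.
    rewrite !eqxx /=; case: ifP => [cU|/negP cU].
      by case/andP: cU => cU dU; rewrite inE /= cU dE ?inE //= eqxx dU mul1r.
    case: ifP => // pY; have := pY; rewrite inE /= => cU1;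
      rewrite dE //= eqxx /=.
    by case: eqP => dU; [case: cU; rewrite cU1 dU eqxx | rewrite !mul0r].
  by case: ifP => // pY; rewrite dE // (negPf pc) !mul0r.
rewrite (big_enum_val (fun p => d p * al p * eigenfun psi r p.1 p.2 y)).
apply: eq_bigr => j _; rewrite !mxE enum_rankK /al.
by congr (_ * _ * _); rewrite enum_valK_in.
Qed.

End Independence.

(** * The number of eigenvectors *)

Section Cardinality.
Variables (F : finFieldType) (H : vectType F) (h : {vspace H}).
Local Notation X := (attenuated h).
Local Notation M := (\dim h).
Local Notation N := (\dim (h^C)%VS).
Implicit Types (y : X) (U W : {vspace H}) (c : M.-tuple 'rV[F]_N).

Lemma limg_vlift : limg (vlift h) = (h^C)%VS.
Proof.
apply/eqP; rewrite eqEdim; apply/andP; split.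
  by apply/subvP => _ /memv_imgP[u _ ->]; apply: vlift_mem.
rewrite limg_dim_eq; first by rewrite dimvf /dim /= mul1n.
by rewrite (eqP (lker_vlift h)) capv0.
Qed.

(* [y] is the graph of a linear map from [W / h] to [h]; its M coordinates are
   linear forms on [W / h], read in a basis as vectors of [W / h]. *)
Definition graph_code W (y : {vspace H}) : M.-tuple 'rV[F]_N :=
  [tuple ((vlift h)^-1)%VF (\sum_(k < \dim (W :&: h^C)%VS) coord (vbasis h) j
     (projv h (daddv_pi y h (vbasis (W :&: h^C)%VS)`_k)) *:
        (vbasis (W :&: h^C)%VS)`_k) | j < M].

Lemma vlift_graph_code W (y : {vspace H}) j :
  vlift h (tnth (graph_code W y) j) = \sum_(k < \dim (W :&: h^C)%VS) coord
    (vbasis h) j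
     (projv h (daddv_pi y h (vbasis (W :&: h^C)%VS)`_k)) *:
        (vbasis (W :&: h^C)%VS)`_k.
Proof.
rewrite tnth_mktuple limg_lfunVK // limg_vlift memv_suml // => k _.
rewrite memvZ // (subvP (capvSr W _)) // vbasis_mem // mem_nth //.
by rewrite size_tuple.
Qed.

Lemma hull_graph_code W y : (val y + h)%VS = W ->
  (hull (graph_code W (val y)) <= W)%VS.
Proof.
move=> yW; rewrite subv_add -{1}yW addvSr; apply/span_subvP.
move=> _ /mapP[u /tnthP[j ->] ->]; rewrite vlift_graph_code memv_suml // => k _.
rewrite memvZ // (subvP (capvSl _ (h^C)%VS)) // vbasis_mem // mem_nth //.
by rewrite size_tuple.
Qed.

(** The components in y1 and in y2 of a basis vector of [W :&: h^C] differ by an element of h, and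
    equal codes give them the same projection to h; so they coincide. Hence the projections of W
    onto y1 and y2 along h agree, and so do their images. *)
Lemma graph_code_inj W y1 y2 : (val y1 + h)%VS = W -> (val y2 + h)%VS = W ->
  graph_code W (val y1) = graph_code W (val y2) -> y1 = y2.
Proof.
move=> y1W y2W eq_code.
have y1h := attenuated_cap y1; have y2h := attenuated_cap y2.
pose B := (W :&: h^C)%VS; pose e := vbasis B.
have eB k : e`_k \in B.
  have [ke|ke] := ltnP k (size e); last by rewrite nth_default // mem0v.
  by rewrite vbasis_mem // mem_nth.
have pi_e (k : 'I_(\dim B)) :
    daddv_pi (val y1) h e`_k = daddv_pi (val y2) h e`_k.
  have eW : e`_k \in W by apply: (subvP (capvSl W (h^C)%VS)); apply: eB.
  set u1 := daddv_pi _ _ _; set u2 := daddv_pi _ _ _.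
  have coordE j : coord (vbasis h) j (projv h u1) = coord (vbasis h) j (projv h
    u2).
    have := congr1 (fun c => coord e k (vlift h (tnth c j))) eq_code.
    by rewrite !vlift_graph_code !coord_sum_free // (basis_free (vbasisP B)).
  have u12h : u1 - u2 \in h.
    have /memvB sub : e`_k - u2 \in h by rewrite daddv_pi_sub // y2W.
    have := sub (e`_k - u1); rewrite daddv_pi_sub ?y1W // => /(_ isT).
    by rewrite opprB addrC addrA subrK.
  have proj12 : projv h u1 = projv h u2.
    rewrite (coord_vbasis (memv_proj h u1)) (coord_vbasis (memv_proj h u2)).
    by apply: eq_bigr => j _; rewrite coordE.
  by apply/eqP; rewrite -subr_eq0 -(projv_id u12h) linearB /= proj12 subrr.
have Bh : (B + h)%VS = W.
  rewrite addvC /B [(W :&: _)%VS]capvC vspace_modl ?addv_complf ?capfv //.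
  by rewrite -y1W addvSr.
have pi_h (y : X) u : u \in h -> daddv_pi (val y) h u = 0.
  by move=> uh; apply: daddv_piP; rewrite ?attenuated_cap ?mem0v ?subr0.
have pi_W u : u \in W -> daddv_pi (val y1) h u = daddv_pi (val y2) h u.
  rewrite -Bh => /memv_addP[b bB [v vh ->]];
    rewrite !linearD /= (pi_h y1 v) // (pi_h y2 v) // !addr0.
  rewrite (coord_vbasis bB) !linear_sum /=; apply: eq_bigr => k _.
  by rewrite !linearZ /= pi_e.
apply/val_inj/eqP; rewrite eqEdim; apply/andP; split.
  apply/subvP => u uy1; have uW : u \in W by rewrite -y1W (subvP (addvSl _ _)).
  by rewrite -(daddv_pi_id y1h uy1) pi_W // memv_pi.
by rewrite -(leq_add2r M) -!dim_attenuated_add y1W y2W.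
Qed.

(** An injection is enough: together with the independence of the eigenvectors, it makes them a
    basis. *)
Lemma card_attenuated_le : (#|X| <= #|pairs h|)%N.
Proof.
pose code (y : X) := (graph_code (val y + h)%VS (val y), (val y + h)%VS).
have code_inj : injective code.
  move=> y1 y2 eq12; have eqW : (val y1 + h = val y2 + h)%VS := congr1 snd eq12.
  apply: (@graph_code_inj (val y1 + h)%VS y1 y2) => //.
  by have /= -> := congr1 fst eq12; rewrite eqW.
rewrite -(card_codom code_inj); apply/subset_leq_card/subsetP => p.
by case/codomP => y ->; rewrite inE; apply: hull_graph_code.
Qed.

End Cardinality.

(** An F_p-linear coordinate of F, used as exponent of a p-th root of unity other than 1. *)
Lemma exists_additive_character (F : finFieldType) (K : numClosedFieldType) :
  exists psi : F -> K, [/\ {morph psi : a b / a + b >-> a * b}, psi 0 = 1 &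
                         exists a, psi a != 1].
Proof.
have [p pr_p pF] := finPcharP F; have p_gt1 := prime_gt1 pr_p.
(* z is a root of 1 + X + ... + X^(p-1), whose value at 1 is p, nonzero in characteristic 0. *)
have [z z1 zp] : exists2 z : K, z != 1 & z ^+ p = 1.
  have sz : size (\poly_(i < p) 1 : {poly K}) != 1%N.
    by rewrite size_poly_eq ?oner_neq0 // gtn_eqF.
  have [z] := closed_rootP _ sz; rewrite rootE horner_poly => /eqP z0.
  have {}z0 : \sum_(i < p) z ^+ i = 0.
    by rewrite -[RHS]z0; apply: eq_bigr => i _; rewrite mul1r.
  exists z; last by apply/eqP; rewrite -subr_eq0 subrX1 z0 mulr0.
  apply: contra_eq_neq z0 => ->; rewrite (eq_bigr (fun _ => 1)).
    by rewrite sumr_const card_ord pnatr_eq0 -lt0n ltnW.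
  by move=> i _; rewrite expr1n.
pose V : vectType 'F_p := pPrimeCharType pF;
  pose e := vbasis (fullv : {vspace V}).
have [k k1] : exists k, coord e k (1 : V) != 0.
  apply/existsP; rewrite -negb_forall;
    apply: contraNN (oner_neq0 F) => /forallP e0.
  rewrite [X in X == _](coord_vbasis (memvf (1 : V))) big1 // => k _.
  by rewrite (eqP (e0 k)) scale0r.
pose lam (a : F) := coord e k (a : V).
have lamD a b : lam (a + b) = lam a + lam b by apply: linearD.
exists (fun a => z ^+ lam a); split => [a b||].
- rewrite lamD /= -exprD -(expr_mod _ zp) -[in RHS](expr_mod _ zp).
  congr (_ ^+ _); move: (nat_of_ord (lam a) + nat_of_ord (lam b))%N => s.
  by rewrite (Fp_cast pr_p) modn_mod.
- by rewrite /lam linear0.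
(* Scaled to have coordinate 1, so that the character takes the value z there. *)
exists ((lam 1)^-1 *: (1 : V)).
have -> : lam ((lam 1)^-1 *: (1 : V)) = 1 by rewrite /lam linearZ; apply: mulVf.
by rewrite expr1.
Qed.

(** * Eigenvalues and multiplicities *)

Section Numbers.
Variables (R : realType) (q : nat).
Hypothesis q_gt1 : (1 < q)%N.
Local Notation qR := (q%:R : R).

Lemma qbinomE n m : qbinom R q n (Posz m) = gbin qR n m.
Proof.
have q1 : 1 < qR by rewrite ltr1n.
have q10 : qR - 1 != 0 by have := qX_neq1 q1 0; rewrite expr1.
have qintS k : qint R q k.+1 != 0.
  by rewrite /qint mulf_neq0 ?invr_eq0 // qX_neq1.
have qfactS k : qfact R q k.+1 = qint R q k.+1 * qfact R q k.
  by rewrite /qfact big_nat_recr //= mulrC.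
have qfact0 : qfact R q 0 = 1 by rewrite /qfact big_geq.
have qfact_neq0 k : qfact R q k != 0.
  by elim: k => [|k IHk]; rewrite ?qfact0 ?oner_neq0 // qfactS mulf_neq0.
rewrite /qbinom lez_nat /=; case: ifPn;
  last by rewrite -ltnNge => /gbin_small->.
elim: n m => [|n IHn] [|m] // le_mn.
- by rewrite gbinn0 subn0 qfact0 !mulr1 divr1.
- by rewrite gbinn0 subn0 qfact0 mul1r divff.
rewrite gbinSS -IHn // subSS !qfactS /qint.
by field; rewrite !qfact_neq0 q10 qX_neq1.
Qed.

Lemma muE N M r : mu R q N M r =
  gbin qR M r * \prod_(j < r) (qR ^+ N - qR ^+ j).
Proof.
have q1 : 1 < qR by rewrite ltr1n.
by rewrite /mu !qbinomE mulrAC mulrC big_mkord gbin_prod.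
Qed.

(** At i = k - rho/2 both powers of q contain q^(rho/2), which joins q^(M/2) to form the factor s of
    [eigenval]; the remaining exponents are natural numbers. *)
Lemma theta_half N M k rho : (rho <= k <= N)%N ->
  theta q N M (k%:R - rho%:R / 2 : R) =
  Num.sqrt qR ^+ (M + rho) * (qR ^+ (N - k) - qR ^+ (k - rho)) / (qR - 1).
Proof.
case/andP => rk kN.
have q0 : 0 < qR by rewrite ltr0n ltnW.
have sqrtX n : Num.sqrt qR ^+ n = qR `^ (n%:R / 2).
  by rewrite -powR12_sqrt ?ltW // -powR_mulrn ?powR_ge0 // -powRrM mulrC.
have pD (x y : R) : qR `^ (x + y) = qR `^ x * qR `^ y 
  by rewrite powRD // (gt_eqF q0) implybT.
have iE : k%:R - rho%:R / 2 = (k - rho)%:R + rho%:R / 2 :> R.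
  by rewrite natrB //; field.
have NiE : N%:R - (k%:R - rho%:R / 2) = (N - k)%:R + rho%:R / 2 :> R.
  by rewrite natrB //; ring.
rewrite /theta NiE iE.
rewrite !pD !powR_mulrn ?ltW // exprD !sqrtX.
by ring.
Qed.

(** [theta] is strictly decreasing on all of R. So an eigenvalue determines k - rho/2, though not k
    and rho themselves. *)
Lemma theta_inj N M : injective (theta q N M : R -> R).
Proof.
have q1 : 1 < qR by rewrite ltr1n.
have q0 : 0 < qR by rewrite ltr0n ltnW.
have ltp (i j : R) : i < j -> qR `^ i < qR `^ j.
  move=> ij; rewrite lt_neqAle ler_powR ?ltW // andbT.
  apply: contraTneq ij => /(congr1 (@ln R)); rewrite !ln_powR => /mulIf.
  by move=> -> //; rewrite ?ltxx // gt_eqF // ln_gt0.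
have lt (i j : R) : i < j ->
    qR `^ (N%:R - j) - qR `^ j < qR `^ (N%:R - i) - qR `^ i.
  by move=> ij; rewrite ltrB // ltp // ltrD2l ltrN2.
move=> i j; rewrite /theta.
have pM : qR `^ (M%:R / 2) != 0 by rewrite gt_eqF // powR_gt0.
have q10 : (qR - 1)^-1 != 0 by rewrite invr_eq0 subr_eq0 gt_eqF.
move=> /(mulIf pM) /(mulIf q10) eq_ij.
by case: (ltgtP i j) => // /lt; rewrite eq_ij ltxx.
Qed.

End Numbers.

(** At least n independent vectors of an n-space form a basis; E sends each to itself or to 0, so
    those it fixes form a basis of its image. *)
Lemma dim_limg_eigenbasis (K : fieldType) (n m : nat) (v : m.-tuple 'cV[K]_n)
    (E : 'M[K]_n) (S : {set 'I_m}) :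
  (n <= m)%N -> free v ->
  (forall j, E *m tnth v j = (j \in S)%:R *: tnth v j) ->
  \dim (limg (linfun (mulmx E : 'cV[K]_n -> 'cV[K]_n))) = #|S|.
Proof.
move=> nm fv Ev.
have vE : v = [seq tnth v j | j <- enum 'I_m] :> seq _.
  by rewrite map_tnth_enum.
have basis_v : basis_of fullv v.
  rewrite basisEfree fv subvf dimvf size_tuple /dim /= muln1 nm.
  by [].
have /span_basis spanv := basis_v.
pose s := [seq j <- enum 'I_m | j \in S].
have sizeS : size s = #|S|.
  rewrite cardE; apply/perm_size/uniq_perm.
  - by apply: filter_uniq; apply: enum_uniq.
  - exact: enum_uniq.
  by move=> j; rewrite mem_filter !mem_enum andbT.
have freeS : free [seq tnth v j | j <- s].
  apply: (@catl_free _ _ [seq tnth v j | j <- enum 'I_m & j \notin S]).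
  by rewrite -map_cat (perm_free (perm_map _ (permEl (perm_filterC _ _)))) -vE.
rewrite -spanv limg_span -sizeS.
have -> : <<[seq linfun (mulmx E : 'cV[K]_n -> 'cV[K]_n) u | u <- v]>>%VS
          = <<[seq tnth v j | j <- s]>>%VS.
  rewrite !span_def [X in map _ X]vE !big_map big_filter enumT [RHS]big_mkcond
    /=.
  apply: eq_bigr => j _; rewrite lfunE /= Ev.
  case: (j \in S); rewrite ?scale1r // scale0r.
  by apply/eqP; rewrite -dimv_eq0 dim_vline eqxx.
by move: freeS; rewrite /free size_map => /eqP.
Qed.

Section QAdjacency.
Variables (R : realType) (F : finFieldType) (H : vectType F) (h : {vspace H}).
Local Notation X := (attenuated h).
Local Notation K := R[i].

Lemma qadj_mx_mul (v : 'cV[K]_#|X|) (i : 'I_#|X|) :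
  (qadj_mx h R *m v) i 0 =
  \sum_(z | covers (enum_val i) z) v (enum_rank z) 0 +
  #|F|%:R ^+ \dim (val (enum_val i)) *
    \sum_(z | covers z (enum_val i)) v (enum_rank z) 0.
Proof.
set y : X := enum_val i.
rewrite mxE (reindex_onto (@enum_rank X) enum_val) => [|k _];
  last exact: enum_valK.
rewrite mulr_sumr [X in _ = X + _]big_mkcond [X in _ = _ + X]big_mkcond
  -[RHS]big_split.
apply: eq_big => z; rewrite ?enum_rankK ?eqxx // => _.
rewrite /qadj_mx mxE enum_rankK -/y natrX.
have [/andP[_ /eqP dy]|yz] := boolP (covers y z).
  rewrite /= mul1r ifN ?addr0 //; apply/negP => /andP[_ /eqP dz].
  by move: dy; rewrite dz => /eqP; rewrite -addn2 -{1}[\dim _]addn0 eqn_add2l.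
by case: ifP => _; rewrite /= add0r ?mul0r.
Qed.

Lemma qadj_mx_eigen (psi : F -> K) (r : K) (j : 'I_#|pairs h|) :
  {morph psi : a b / a + b >-> a * b} -> (exists a, psi a != 1) ->
  r ^+ 2 = #|F|%:R ->
  qadj_mx h R *m col j (eigenmx h psi r) =
  pair_eigenval r (enum_val j) *: col j (eigenmx h psi r).
Proof.
move=> psiD psi1 r2; apply/colP => i; rewrite qadj_mx_mul !mxE.
have := enum_valP j; rewrite inE => jY.
rewrite -(eigenfunP psiD psi1 r2 _ jY).
by congr (_ + _ * _); apply: eq_bigr => z _; rewrite !mxE enum_rankK.
Qed.

End QAdjacency.

(** * Counting eigenvectors by eigenvalue *)

Lemma double_eq_half (J M rho u : nat) : (M + rho <= u)%N ->
  (2 * (u - M) == J + rho)%N =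
  [&& (rho < J.+1)%N, odd rho == odd J & u == (M + rho + (J - rho)./2)%N].
Proof.
move=> le; apply/eqP/and3P => [uE | [lt /eqP par /eqP uE]]; last first.
  have := odd_double_half (J - rho); rewrite oddB // par addbb; lia.
have le_rJ : (rho <= J)%N by lia.
split; [by lia | | apply/eqP].
  by apply/eqP; have := congr1 odd uE; rewrite oddM oddD /=; case: odd;
    case: odd.
have : (J - rho = (u - M - rho).*2)%N by lia.
by move=> ->; rewrite doubleK; lia.
Qed.

(** Here J = 2i. For c of rank rho the condition puts U exactly (J - rho)/2 dimensions above
    [hull c], whose codimension is N - rho, and it forces rho to have the parity of J. *)
Lemma card_pairs (K : numFieldType) (F : finFieldType) (H : vectType F)
    (h : {vspace H}) (J : nat) :
  let q : K := #|F|%:R in let M := \dim h in let N := \dim (h^C)%VS in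
  #|[set p in pairs h | (2 * (\dim p.2 - M) == J + \dim <<p.1>>)%N]|%:R =
  \sum_(rho < J.+1 | odd rho == odd J)
    gbin q M rho * (\prod_(j < rho) (q ^+ N - q ^+ j)) *
      gbin q (N - rho) (J - rho)./2.
Proof.
move=> q M N; rewrite -sum1_card natr_sum.
pose P (c : M.-tuple 'rV[F]_N) (U : {vspace H}) :=
  (hull c <= U)%VS && (2 * (\dim U - M) == J + \dim <<c>>)%N.
rewrite (eq_bigl (fun p => P p.1 p.2)); last by move=> p; rewrite !inE.
rewrite -(pair_big_dep xpredT P (fun _ _ => 1%:R)) /=.
pose g rho : K := gbin q (N - rho) (J - rho)./2.
have cardU (c : M.-tuple 'rV[F]_N) : \sum_(U | P c U) 1%:R =
    if (\dim <<c>> < J.+1)%N && (odd (\dim <<c>>) == odd J)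
    then g (\dim <<c>>) else 0.
  have PE U : P c U = [&& (\dim <<c>> < J.+1)%N, odd (\dim <<c>>) == odd J &
      U \in interval (hull c) fullv (J - \dim <<c>>)./2].
    rewrite /P inE subvf andbT dim_hull.
    have [cU|] := boolP (hull c <= U)%VS; last by rewrite !andbF.
    have := dimvS cU; rewrite dim_hull /= -/M.
    exact: double_eq_half.
  case: ifP => [/andP[lt par]|lt_par]; last first.
    by rewrite big1 // => U; rewrite PE andbA lt_par.
  have -> : g (\dim <<c>>) = gbin q (\dim (fullv : {vspace H}) - \dim (hull c))
                                 (J - \dim <<c>>)./2.
    by congr gbin; rewrite dim_hull subnDA -dimv_compl.
  rewrite -card_interval ?subvf //.
  rewrite -sum1_card natr_sum.
  by apply: eq_bigl => U; rewrite PE lt par.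
rewrite (eq_bigr _ (fun c _ => cardU c)) -big_mkcond /=.
rewrite (partition_big (fun c : M.-tuple 'rV[F]_N => inord (\dim <<c>>))
           (fun rho : 'I_J.+1 => odd rho == odd J)) /=; last first.
  by move=> c /andP[lt par]; rewrite inordK.
apply: eq_bigr => rho par; rewrite -card_tuple_span mulr_natl -sumr_const.
apply: eq_big => [c|c /andP[/andP[lt _] /eqP <-]]; last by rewrite inordK.
rewrite inE; apply/idP/idP.
  by case/andP => /andP[lt _] /eqP <-; rewrite inordK.
move=> /eqP crho; rewrite crho ltn_ord par /=; apply/eqP/val_inj.
by rewrite /= inordK ?ltn_ord.
Qed.

Lemma sum_same_parity (V : nmodType) (f : nat -> V) (J : nat) :
  \sum_(rho < J.+1 | odd rho == odd J) f rho =
  \sum_(0 <= k < J./2.+1) f (odd J + k.*2)%N.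
Proof.
pose P n := \sum_(rho < n.+1 | odd rho == odd n) f rho =
  \sum_(0 <= k < n./2.+1) f (odd n + k.*2)%N.
have step n : P n -> P n.+2.
  rewrite /P => Pn; rewrite big_mkcond 2!big_ord_recr /= -big_mkcond /=.
  rewrite !negbK eqxx (negbTE (_ : ~~ (~~ odd n == odd n))); last first.
    by case: (odd n).
  rewrite addr0 Pn [RHS]big_nat_recr //=; congr (_ + f _).
  by rewrite doubleS !addnS odd_double_half.
suff [//] : P J /\ P J.+1.
elim: J => [|J [PJ PJ1]]; last by split => //; apply: step.
split; rewrite /P big_mkord /=.
  by rewrite !big_ord1 big_mkcond big_ord1.
by rewrite big_ord1 big_mkcond !big_ord_recl big_ord0 /= add0r addr0.
Qed.

(** The doubled index J = 2i treats integral and half-integral i together: the ranks start at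
    [odd J] and increase by 2. *)
Lemma dim_eigenspace (R : realType) (F : finFieldType) (H : vectType F)
    (h : {vspace H}) (J : nat) (E : 'M[R[i]]_#|attenuated h|) :
  let q := #|F| in let M := \dim h in let N := \dim (h^C)%VS in
  primitive_idempotent (qadj_mx h R)
    (real_complex R (theta q N M (J%:R / 2))) E ->
  (\dim (limg (linfun (mulmx E :
     'cV_#|attenuated h| -> 'cV_#|attenuated h|))))%:R =
  \sum_(0 <= k < J./2.+1)
     mu R q N M (odd J + k.*2) *
     qbinom R q (N - (odd J + k.*2)) (Posz (J./2 - k)).
Proof.
move=> q M N [E1 E0].
have q_gt1 : (1 < q)%N := finNzRing_gt1 F.
have q0 : 0 < q%:R :> R by rewrite ltr0n ltnW.
have [psi [psiD psi0 psi1]] := exists_additive_character F R[i].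
pose r := real_complex R (Num.sqrt q%:R).
have r2 : r ^+ 2 = q%:R by rewrite -rmorphXn /= sqr_sqrtr ?ltW // rmorph_nat.
have eigenvalE p : p \in pairs h -> pair_eigenval r p =
    real_complex R (theta q N M ((\dim p.2 - M)%:R - (\dim <<p.1>>)%:R / 2)).
  case/dim_pairs => le _; rewrite theta_half // /pair_eigenval /eigenval /r.
  rewrite [RHS]fmorph_div !rmorphM !rmorphB !rmorphXn /= !rmorph_nat.
  by rewrite rmorph1.
pose theta_i := real_complex R (theta q N M (J%:R / 2)).
pose P := eigenmx h psi r.
have AP j : qadj_mx h R *m col j P = pair_eigenval r (enum_val j) *: col j P.
  exact: qadj_mx_eigen.
pose v := [tuple col j P | j < #|pairs h|].
have fv : free v.
  apply/freeP => a suma; apply: (eigenmx_free psiD psi0 psi1 r2).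
    by exists (qadj_mx h R).
  rewrite -[RHS]suma; apply: eq_bigr => j _.
  by rewrite (nth_map j) ?size_enum_ord // nth_ord_enum.
pose S := [set j : 'I_#|pairs h| | pair_eigenval r (enum_val j) == theta_i].
rewrite (@dim_limg_eigenbasis _ _ _ v E S) ?card_attenuated_le //; last first.
  move=> j; rewrite tnth_mktuple inE; case: eqVneq => [j_i|j_i].
    by rewrite scale1r E1 // AP j_i.
  by rewrite scale0r; apply: E0 j_i _.
have -> : #|S| = #|[set p in pairs h | (2 * (\dim p.2 - M) == J + \dim
  <<p.1>>)%N]|.
  rewrite -(card_imset _ enum_val_inj); apply: eq_card => p; rewrite inE.
  have thetaE p' : p' \in pairs h -> (pair_eigenval r p' == theta_i) =
      (2 * (\dim p'.2 - M) == J + \dim <<p'.1>>)%N.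
    move=> p'Y; rewrite eigenvalE // /theta_i (inj_eq (@complexI R)).
    rewrite (inj_eq (@theta_inj R q q_gt1 N M)) -(eqr_nat R) natrD natrM.
    by apply/eqP/eqP => e; lra.
  apply/imsetP/andP => [[j] | [pY pJ]].
    rewrite inE => jS ->; have jY := enum_valP j.
    by rewrite -thetaE.
  by exists (enum_rank_in pY p); rewrite ?inE enum_rankK_in // thetaE.
rewrite card_pairs (sum_same_parity (fun rho => gbin (q%:R : R) M rho *
  \prod_(j < rho) (q%:R ^+ N - q%:R ^+ j) * gbin q%:R (N - rho) (J - rho)./2)).
apply: eq_big_nat => k /andP[_ kJ].
rewrite muE // qbinomE // -/q; congr (_ * gbin _ _ _).
by rewrite -{1}(odd_double_half J) subnDl -doubleB doubleK.
Qed.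

Theorem theorem9p14 (R : realType) (F : finFieldType) (H : vectType F)
    (N M : nat) (h : {vspace H}) (N_gt0 : (0 < N)%N) (M_gt0 : (0 < M)%N)
    (dimH : \dim (fullv : {vspace H}) = (N + M)%N) (dimh : \dim h = M)
    (i : R) (iN : i \in half_ints N) (i_le : i <= N%:R / 2)
    (E : 'M[R[i]]_#|attenuated h|)
    (primE : primitive_idempotent (qadj_mx h R)
               (real_complex R (theta #|F| N M i)) E) :
  let q := #|F| in
  let dimEV : nat :=
    \dim (limg (linfun (mulmx E : 'cV_#|attenuated h| -> 'cV_#|attenuated h|)))
  in
  (i \is a Num.int ->
     dimEV%:R =
     \sum_(0 <= k < (Num.truncn i).+1)
       mu R q N M (2 * k) *
       qbinom R q (N - 2 * k) (Num.floor (i - k%:R))) /\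
  (i \isn't a Num.int ->
     dimEV%:R =
     \sum_(0 <= k < Num.truncn (i + 1 / 2))
       mu R q N M (2 * k + 1) *
       qbinom R q (N - (2 * k + 1)) (Num.floor (i - (2 * k + 1)%:R / 2))).
Proof.
move=> q dimEV; subst M.
have NE : N = \dim (h^C)%VS by rewrite dimv_compl dimH addnK.
subst N; set N := \dim (h^C)%VS; set M := \dim h.
case/and3P: iN => /intrP[z zE] i0 _.
have [J iE] : exists J : nat, i = J%:R / 2.
  have z0 : 0 <= z by rewrite -(ler0z R) -zE mulr_ge0.
  by exists `|z|%N; rewrite natr_absz ger0_norm // -zE mulrC mulKf // pnatr_eq0.
have iE2 : i = (odd J)%:R / 2 + (J./2)%:R.
  rewrite iE -{1}(odd_double_half J) -muln2 natrD natrM mulrDl mulfK //.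
  by rewrite pnatr_eq0.
have floorE k : (k <= J./2)%N -> Num.floor ((J./2)%:R - k%:R : R) = Posz (J./2
  - k).
  by move=> kJ; rewrite -natrB // pmulrn intrKfloor.
have dimE : dimEV%:R = \sum_(0 <= k < J./2.+1) mu R q N M (odd J + k.*2) *
     qbinom R q (N - (odd J + k.*2)) (Posz (J./2 - k)).
  by apply: dim_eigenspace; rewrite -iE.
split => iint.
  have oJ : odd J = false.
    case/intrP: iint => m im; have /intr_inj Jm : J%:~R = (m * 2)%:~R :> R.
      by rewrite intrM -im iE divfK // pnatr_eq0.
    by have := congr1 absz Jm; rewrite abszM /= muln2 => ->; rewrite odd_double.
  rewrite dimE iE2 oJ mul0r add0r natrK; apply: eq_big_nat => k /andP[_ kJ].
  by rewrite mul2n floorE.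
have oJ : odd J.
  apply: contraNT iint => /negPf oJ.
  by rewrite iE2 oJ mul0r add0r natr_int.
(* i + 1/2 is the number of odd ranks 1, 3, ..., 2i. *)
have -> : Num.truncn (i + 1 / 2) = J./2.+1.
  rewrite iE2 oJ (_ : _ + _ = J./2.+1%:R) ?natrK //.
  by rewrite -natr1 mulr1n; field.
rewrite dimE; apply: eq_big_nat => k /andP[_ kJ]; rewrite oJ -muln2 mulnC addnC.
congr (_ * qbinom _ _ _ _); rewrite -floorE //; congr (Num.floor _).
by rewrite iE2 oJ natrD natrM mulr1n; field.
Qed.
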